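(* Let $\alpha$ be a composition and $n$ a positive integer. Then in $\mathbf{NSym}$, $$\mathbf{s}_\alpha\cdot\mathbf{s}_{(n)}=\sum \mathbf{s}_{u_{i_n}\cdots u_{i_1}(\alpha)},$$ where the sum ranges over all sequences of positive integers $i_1<i_2<\cdots<i_n$ such that $u_{i_n}\cdots u_{i_1}(\alpha)$ is a composition (necessarily of $|\alpha|+n$), and $$\mathbf{s}_\alpha\cdot\mathbf{s}_{(1^n)}=\sum \mathbf{s}_{u_{i_n}\cdots u_{i_1}(\alpha)},$$ where the sum ranges over all sequences of positive integers $i_1\geq i_2\geq\cdots\geq i_n$ such that $u_{i_n}\cdots u_{i_1}(\alpha)$ is a composition. Here $(1^n)$ is the composition with $n$ parts equal to $1$.
   Context: Compositions have positive parts; $l(\alpha)$ is the number of parts and $|\alpha|$ the sum. For compositions $\alpha,\beta$, write $\alpha\succcurlyeq\beta$ if the parts of $\alpha$ are obtained by adding together adjacent parts of $\beta$ in order. $\mathbf{NSym}=\mathbb{Q}\langle\mathbf{h}_1,\mathbf{h}_2,\ldots\rangle$ is the free associative algebra, with $\mathbf{h}_\alpha=\mathbf{h}_{\alpha_1}\cdots\mathbf{h}_{\alpha_k}$, and the ribbon functions are $\mathbf{r}_\beta=\sum_{\alpha\succcurlyeq\beta}(-1)^{l(\beta)-l(\alpha)}\mathbf{h}_\alpha$. Reverse composition diagram: row $r$ (from the top) of $\alpha$ has $\alpha_r$ left-justified boxes; $(r,c)$ is row $r$, column $c$. A standard reverse composition tableau (SRCT) of shape $\alpha\vDash m$ is a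 bijective filling $\tau$ of the diagram by $\{1,\ldots,m\}$ such that rows decrease from left to right, the first column increases from top to bottom, and for rows $r<s$ and column $c$ with $(s,c+1)$ a box: if $\tau(r,c)>\tau(s,c+1)$ then $(r,c+1)$ is a box and $\tau(r,c+1)>\tau(s,c+1)$. Its descent set is the set of $j\in[m-1]$ such that $j+1$ lies in a column weakly to the right of the column of $j$; if the descent set is $\{j_1<\cdots<j_t\}$, the descent composition is $(j_1,j_2-j_1,\ldots,m-j_t)$. The noncommutative Schur functions $\mathbf{s}_\alpha$ are the unique elements of $\mathbf{NSym}$ with $\mathbf{r}_\beta=\sum_{\alpha\vDash|\beta|}d_{\alpha\beta}\mathbf{s}_\alpha$ for all $\beta$, where $d_{\alpha\beta}$ is the number of SRCTs of shape $\alpha$ with descent composition $\beta$. Operators on compositions: for $i\geq1$, $\mathfrak{d}_i(\alpha)$ is obtained by subtracting $1$ from the rightmost part of $\alpha$ equal to $i$ (deleting a resulting $0$), and $\mathfrak{d}_i(\alpha)=0$ if $\alpha$ has no part equal to $i$; all operators send $0$ to $0$. $\mathfrak{v}_{[i-1]}=\mathfrak{d}_1\mathfrak{d}_2\cdots\mathfrak{d}_{i-1}$ (apply $\mathfrak{d}_{i-1}$ first, then $\mathfrak{d}_{i-2}$, ..., then $\mathfrak{d}_1$; $\mathfrak{v}_{[0]}$ is the identity), $a_i$ appends a part $i$ at the end, and $u_i=a_i\mathfrak{v}_{[i-1]}$. *)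

(* Defs.v *)
From mathcomp Require Import all_boot all_algebra.
Set Implicit Arguments. Unset Strict Implicit. Unset Printing Implicit Defensive.
Import GRing.Theory Num.Theory.
Local Open Scope ring_scope.

Definition is_comp (a : seq nat) : bool := all (fun x => 0 < x)%N a.

Fixpoint comps_rec (f m : nat) : seq (seq nat) :=
  match f with
  | 0 => [:: [::]]
  | f'.+1 => if m is 0 then [:: [::]]
             else flatten [seq map (cons k) (comps_rec f' (m - k)) | k <- iota 1 m]
  end.
Definition comps (m : nat) : seq (seq nat) := comps_rec m m.

Fixpoint coarsen (a b : seq nat) : bool :=
  match a with
  | [::] => b == [::]
  | x :: a' => has (fun k => (sumn (take k b) == x) && coarsen a' (drop k b))
                   (iota 1 (size b))
  end.

(** NSym = Q<h_1,h_2,...>.  An element is represented by its coefficient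
    function on the basis {h_w : w a word (composition)}; the product is the
    concatenation (convolution) product.  (This is the completion of NSym,
    which contains NSym as a subalgebra; all elements occurring below are finite
    combinations.) *)
Definition NSym := seq nat -> rat.

Definition nmul (f g : NSym) : NSym :=
  fun w => \sum_(k < (size w).+1) f (take k w) * g (drop k w).

Definition nsum (I : Type) (L : seq I) (F : I -> NSym) : NSym :=
  fun w => \sum_(x <- L) F x w.

Definition hh (a : seq nat) : NSym := fun w => (w == a)%:R.

Definition ribbon (b : seq nat) : NSym :=
  fun w => \sum_(a <- comps (sumn b) | coarsen a b)
             (-1) ^+ (size b - size a) * hh a w.

(** Standard reverse composition tableaux: a filling is a list of rows
    (row r from the top), entries indexed from 0 in each row. *)
Definition triple_rule (t : seq (seq nat)) : bool :=
  all (fun r => all (fun s =>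
     (r < s)%N ==>
     all (fun c =>
        (c.+1 < size (nth [::] t s))%N ==>
        ((nth 0 (nth [::] t s) c.+1 < nth 0 (nth [::] t r) c)%N ==>
         ((c.+1 < size (nth [::] t r))%N &&
          (nth 0 (nth [::] t s) c.+1 < nth 0 (nth [::] t r) c.+1)%N)))
       (iota 0 (size (nth [::] t s))))
     (iota 0 (size t))) (iota 0 (size t)).

Definition is_SRCT (al : seq nat) (t : seq (seq nat)) : bool :=
  [&& map size t == al,
      perm_eq (flatten t) (iota 1 (sumn al)),
      all (fun row => sorted gtn row) t,
      sorted ltn (map (head 0%N) t) &
      triple_rule t].

Definition colof (t : seq (seq nat)) (v : nat) : nat :=
  index v (nth [::] t (find (fun row => v \in row) t)).

Definition descomp (t : seq (seq nat)) : seq nat :=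
  let m := size (flatten t) in
  let des := [seq j <- iota 1 m.-1 | (colof t j <= colof t j.+1)%N] in
  if m == 0%N then [::] else pairmap (fun a b => b - a)%N 0%N (rcons des m).

Definition fillings (al : seq nat) : seq (seq (seq nat)) :=
  [seq reshape al p | p <- permutations (iota 1 (sumn al))].

Definition dcoef (al be : seq nat) : nat :=
  count (fun t => is_SRCT al t && (descomp t == be)) (fillings al).

Definition is_ncschur (s : seq nat -> NSym) : Prop :=
  forall b, is_comp b ->
    ribbon b =1 (fun w => \sum_(a <- comps (sumn b)) (dcoef a b)%:R * s a w).

(** Operators on compositions; None stands for 0. *)
Definition dop (i : nat) (a : seq nat) : option (seq nat) :=
  let ra := rev a in
  let k := index i ra in
  if i \in a then
    Some (rev (if i == 1%N then take k ra ++ drop k.+1 ra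
               else set_nth 0%N ra k i.-1))
  else None.

Definition vop (i : nat) (a : seq nat) : option (seq nat) :=
  foldr (fun j acc => obind (dop j) acc) (Some a) (iota 1 i.-1).

Definition uop (i : nat) (a : seq nat) : option (seq nat) :=
  omap (fun b => rcons b i) (vop i a).

Definition uapp (x : seq nat) (a : seq nat) : option (seq nat) :=
  foldl (fun acc i => obind (uop i) acc) (Some a) x.

Definition valid_row (al : seq nat) (n : nat) (x : seq nat) : bool :=
  [&& size x == n, all (fun i => 0 < i)%N x, sorted ltn x & uapp x al != None].

Definition valid_col (al : seq nat) (n : nat) (x : seq nat) : bool :=
  [&& size x == n, all (fun i => 0 < i)%N x, sorted geq x & uapp x al != None].

(* Main.v *)
(** A tableau is encoded by the word listing the columns of its entries 1, 2, ...;
    adding the entries in decreasing order makes the words of tableaux the ones along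
    which "prepend a part 1, or increase the leftmost part c - 1 to c" never fails, and
    the descents of the tableau are the weak ascents of the word.  Every ribbon is thus
    a sum of noncommutative Schur functions over words with prescribed ascents.

    Such a word ends with 1.  Deleting this last letter and repairing the word from
    right to left (the first letter k + 1 that is no longer allowed becomes k, and then
    k + 1 plays the role of k) is jeu de taquin: it preserves the ascents, and it is a
    bijection onto the pairs (word of shape a, k) with [u_k a] nonzero, the deleted word
    having shape [u_k a].  Iterating it n times, with prescribed comparisons among the
    last n letters, proves the Pieri rules after multiplying by any ribbon.  Ribbons
    determine the noncommutative Schur functions by unitriangularity with respect to
    the statistic [sum of a_i (a_i + 1)]. *)
Require Import Defs.
From mathcomp Require Import all_boot all_algebra zify.
Import GRing.Theory Num.Theory.

(** * The operators on compositions *)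

Fixpoint bump_first (j : nat) (a : seq nat) : seq nat :=
  if a is x :: a' then if x == j then j.+1 :: a' else x :: bump_first j a' else [::].

Definition add_box (c : nat) (a : seq nat) : option (seq nat) :=
  match c with
  | 0 => None
  | 1 => Some (1 :: a)
  | j.+1 => if j \in a then Some (bump_first j a) else None
  end.

(** [dop] finds the rightmost part through a reversed list; this form allows induction from the
    left, like [bump_first]. *)
Fixpoint shrink_last (k : nat) (a : seq nat) : seq nat :=
  if a is x :: a' then
    if k \in a' then x :: shrink_last k a'
    else if x == k then (if k == 1 then a' else k.-1 :: a') else a
  else [::].

Lemma add_boxE j a : 0 < j -> add_box j.+1 a = if j \in a then Some (bump_first j a) else None.
Proof. by case: j. Qed.

Lemma shrink_last_cat k A B : k \notin B ->
  shrink_last k (A ++ k :: B) = A ++ (if k == 1 then B else k.-1 :: B).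
Proof.
move=> kB; elim: A => [|x A IH] /=; first by rewrite (negbTE kB) eqxx.
by rewrite mem_cat inE eqxx orbT IH.
Qed.

Lemma mem_split_last (k : nat) a : k \in a -> exists A B, a = A ++ k :: B /\ k \notin B.
Proof.
elim: a => // x a IH; rewrite inE; case ka: (k \in a).
  by move=> _; have [A [B [-> kB]]] := IH ka; exists (x :: A), B.
by rewrite orbF => /eqP <-; exists [::], a; rewrite ka.
Qed.

Lemma dopE k a : dop k a = if k \in a then Some (shrink_last k a) else None.
Proof.
rewrite /dop; case: ifP => // ka; congr Some.
have [A [B [-> kB]]] := mem_split_last _ _ ka.
rewrite shrink_last_cat // rev_cat rev_cons cat_rcons.
have -> : index k (rev B ++ k :: rev A) = size (rev B).
  by rewrite index_cat mem_rev (negbTE kB) /= eqxx addn0.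
rewrite take_size_cat // -cat_rcons drop_size_cat ?size_rcons // cat_rcons.
case: eqP => _; first by rewrite rev_cat !revK.
have -> : forall y, set_nth 0 (rev B ++ k :: rev A) (size (rev B)) y = rev B ++ y :: rev A.
  by move=> y; elim: (rev B) => //= z s ->.
by rewrite rev_cat rev_cons !revK cat_rcons.
Qed.

Definition mult (y : nat) (a : seq nat) : nat := count_mem y a.

Arguments mult : simpl never.

Lemma mult_cons y x a : mult y (x :: a) = (x == y) + mult y a.
Proof. by []. Qed.

Lemma mem_mult (y : nat) a : (y \in a) = (0 < mult y a).
Proof. by rewrite -has_count has_pred1. Qed.

(** Membership after an operator is deduced from multiplicities by linear arithmetic; the additive
    form avoids truncated subtraction. *)
Lemma mult_bump_first y j a : j \in a ->
  mult y (bump_first j a) + (y == j) = mult y a + (y == j.+1).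
Proof.
elim: a => //= x a IH; rewrite inE (eq_sym j x) mult_cons.
case: (altP (x =P j)) => [->|xj] /=; last by move=> ja; have := IH ja; rewrite mult_cons; lia.
by rewrite mult_cons => _; lia.
Qed.

Lemma mult_shrink_last y k a : 0 < y -> k \in a ->
  mult y (shrink_last k a) + (y == k) = mult y a + (y == k.-1).
Proof.
move=> y0; elim: a => //= x a IH; rewrite inE (eq_sym k x).
case: ifP => [ka _|ka] /=; first by have := IH ka; rewrite !mult_cons; lia.
rewrite orbF mult_cons => /eqP ->; rewrite eqxx.
by case: eqP => [->|] /=; rewrite ?mult_cons; lia.
Qed.

Lemma mem_bump_first_neq y j a : y != j -> y != j.+1 -> j \in a -> (y \in bump_first j a) = (y \in a).
Proof. by move=> h1 h2 /(mult_bump_first y); rewrite !mem_mult; lia. Qed.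

Lemma mem_shrink_last_neq y k a : 0 < y -> y != k -> y != k.-1 -> k \in a ->
  (y \in shrink_last k a) = (y \in a).
Proof. by move=> y0 h1 h2 /(mult_shrink_last _ _ _ y0); rewrite !mem_mult; lia. Qed.

Lemma bump_first_notin j a : j \notin a -> bump_first j a = a.
Proof. by elim: a => //= x a IH; rewrite inE eq_sym; case: eqP => //= _ /IH ->. Qed.

Lemma mem_bump_first_succ j a : j \in a -> j.+1 \in bump_first j a.
Proof. by move=> ja; rewrite mem_mult; have := mult_bump_first j.+1 j a ja; rewrite eqxx; lia. Qed.

Lemma mem_shrink_last_pred k a : k.+2 \in a -> k.+1 \in shrink_last k.+2 a.
Proof. by move=> ka; rewrite mem_mult; have := mult_shrink_last k.+1 k.+2 a isT ka; rewrite eqxx; lia. Qed.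

Lemma bump_firstK j a : 0 < j -> j \in a -> j.+1 \notin a -> shrink_last j.+1 (bump_first j a) = a.
Proof.
move=> j0; elim: a => //= y a IH; rewrite !inE (eq_sym j y) (eq_sym j.+1 y).
case: eqP => [-> _|_ /= ja].
  by case: eqP => //= _ ka; rewrite (negbTE ka) eqxx; case: eqP => //; lia.
by case: eqP => //= yj ka; rewrite mem_bump_first_succ ?IH.
Qed.

Lemma shrink_lastK k a : k.+2 \in a -> k.+1 \notin a -> bump_first k.+1 (shrink_last k.+2 a) = a.
Proof.
elim: a => //= y a IH; rewrite !inE (eq_sym k.+1 y) (eq_sym k.+2 y).
rewrite negb_or => + /andP[yk ja]; case: ifP => [ka _|ka] /=.
  by rewrite (negbTE yk) IH.
by rewrite orbF => /eqP ->; rewrite !eqxx /= eqxx.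
Qed.

(** Since [k != j.+1], neither operator creates a part that the other looks for; for [j = k] a
    second copy keeps the leftmost and the rightmost apart. *)
Lemma shrink_last_bump_first j k a : 0 < j -> 0 < k -> k != j.+1 -> j \in a -> k \in a ->
  (j = k -> 1 < mult k a) -> shrink_last k (bump_first j a) = bump_first j (shrink_last k a).
Proof.
move=> j0 k0 kj; elim: a => //= x a IH ja ka cnt.
have [xj|xj] := altP (x =P j).
  subst x; case: ifP => ka'; first by rewrite /= ka' eqxx.
  move: ka ja cnt; rewrite !inE ka' orbF => /eqP kj' _; subst k => /(_ erefl).
  rewrite mult_cons eqxx => h; have : j \in a by rewrite mem_mult; move: h; lia.
  by rewrite ka'.
move: ja; rewrite inE eq_sym (negbTE xj) /= => ja.
have [kj'|kj'] := altP (j =P k).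
  subst k; rewrite ja /= (negbTE xj).
  have c2 : 1 < mult j a by have := cnt erefl; rewrite mult_cons (negbTE xj).
  have -> : j \in bump_first j a by rewrite mem_mult; have := mult_bump_first j j a ja; lia.
  by rewrite IH.
rewrite mem_bump_first_neq //; last by rewrite eq_sym.
case: ifP => ka'; first by rewrite /= (negbTE xj) IH // => jk; rewrite jk eqxx in kj'.
move: ka; rewrite inE ka' orbF => /eqP kx; subst x; rewrite eqxx /=.
by case: eqP => // k1; rewrite /=; have -> : (k.-1 == j) = false by lia.
Qed.

(** If the leftmost [j] precedes the rightmost [j.+1], the operators act on separate parts.
    Otherwise the second operator undoes the first in either order, and both sides are [a]. *)
Lemma shrink_last_bump_first_adj j a : 0 < j -> j \in a -> j.+1 \in a ->
  shrink_last j.+1 (bump_first j a) = bump_first j (shrink_last j.+1 a).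
Proof.
move=> j0; elim: a => //= x a IH.
have mem_add_box b : j.+1 \in b -> j.+1 \in bump_first j b.
  by move=> h; case jb: (j \in b); [have := mult_bump_first j.+1 j b jb|rewrite bump_first_notin ?jb];
     move: h; rewrite ?mem_mult; lia.
rewrite !inE; have [xj|xj] := altP (x =P j).
  subst x; case: ifP => ka' _; first by rewrite /= ka' eqxx.
  by rewrite orbF; lia.
rewrite eq_sym (negbTE xj) /= => ja.
case ka': (j.+1 \in a).
  by move=> _; rewrite mem_add_box //= (negbTE xj) IH.
rewrite orbF => /eqP xE; subst x; rewrite eqxx /=.
have -> : j.+1 \in bump_first j a.
  by rewrite mem_mult; have := mult_bump_first j.+1 j a ja; rewrite eqxx; lia.
case: eqP => [|_]; first lia.
by rewrite /= eqxx bump_firstK ?ka'.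
Qed.

Lemma dop_add_boxK k a : 0 < k -> k \notin a -> (k == 1) || (k.-1 \in a) ->
  obind (dop k) (add_box k a) = Some a.
Proof.
case: k => [|[|j]] //= _ ka.
  by rewrite dopE inE eqxx /= (negbTE ka).
by move=> ja; rewrite ja /= dopE mem_bump_first_succ // bump_firstK.
Qed.

(** In the excluded case [c = k > 1] without part [k.-1], no box can be added to [a], whereas
    [dop k] creates a part to which it can be added. *)
Lemma dop_add_box_comm c k a : 0 < k -> 0 < c -> k \in a ->
  (c == k) ==> ((k == 1) || (k.-1 \in a)) ->
  obind (dop k) (add_box c a) = obind (add_box c) (dop k a).
Proof.
move=> k0; case: c => [|[|j]] // _ ka.
  by move=> _; rewrite /= !dopE inE ka orbT /= ka.
move=> h; rewrite [dop k a]dopE ka [RHS]/= [add_box _ _]/=.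
have [kj|kj] := altP (k =P j.+2).
  move: h; subst k; rewrite eqxx /= => ja; rewrite ja /= dopE.
  have -> : j.+2 \in bump_first j.+1 a.
    by move: ka; rewrite !mem_mult; have := mult_bump_first j.+2 j.+1 a ja; lia.
  have -> : j.+1 \in shrink_last j.+2 a.
    by move: ja; rewrite !mem_mult; have := mult_shrink_last j.+1 j.+2 a isT ka; lia.
  by rewrite shrink_last_bump_first_adj.
have [kj'|kj'] := altP (k =P j.+1).
  subst k; rewrite ka /= dopE !mem_mult.
  have := mult_bump_first j.+1 j.+1 a ka; have := mult_shrink_last j.+1 j.+1 a isT ka.
  rewrite eqxx => h1 h2; have -> : mult j.+1 (shrink_last j.+1 a) = mult j.+1 (bump_first j.+1 a) by lia.
  by case: ifP => // h3; rewrite shrink_last_bump_first //; lia.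
rewrite mem_shrink_last_neq // 1?eq_sym //; last by lia.
case: ifP => // ja; rewrite /= dopE mem_bump_first_neq // ka.
by rewrite shrink_last_bump_first // => jk; rewrite jk eqxx in kj'.
Qed.

Lemma vopS k a : 0 < k -> vop k.+1 a = obind (vop k) (dop k a).
Proof.
case: k => // k _.
rewrite /vop -[k.+2.-1]addn1 iotaD foldr_cat /= add1n /=.
by case: (dop k.+1 a) => //=; elim: (iota 1 k) => //= x s ->.
Qed.

(** Each [dop j] with [j > 1] leaves a part [j.-1] for the next operator, so only the first one can
    fail. *)
Lemma vop_neqNone k a : 0 < k -> (vop k a != None) = ((k == 1) || (k.-1 \in a)).
Proof.
case: k => // k _; elim: k a => // k IH a.
rewrite vopS // dopE /=; case: ifP => //= ka; rewrite IH; case: k ka {IH} => // k ka.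
by rewrite mem_mult /=; have := mult_shrink_last k.+1 k.+2 a isT ka; rewrite eqxx; lia.
Qed.

Lemma vop_mem {k a g} y : 0 < k -> vop k a = Some g -> k <= y -> (y \in g) = (y \in a).
Proof.
case: k => // k _; elim: k a => [|k IH] a; first by case=> ->.
rewrite vopS // dopE; case: ifP => // ka /= /IH h ky.
by rewrite h ?mem_shrink_last_neq //; lia.
Qed.

(** This commutation drives the slide: later boxes of the word are added equally well before and
    after [vop k]. *)
Lemma vop_add_box {k} c {a g} : 0 < k -> 0 < c -> vop k a = Some g ->
  obind (vop k) (add_box c a) = add_box c g.
Proof.
case: k => // k _ c0; elim: k a => [|k IH] a; first by case=> <-; case: (add_box c a).
rewrite vopS //; case E: (dop k.+1 a) => [a1|] //= /IH <-.
have ka : k.+1 \in a by move: E; rewrite dopE; case: ifP.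
have -> : obind (vop k.+2) (add_box c a) = obind (vop k.+1) (obind (dop k.+1) (add_box c a)).
  by case: (add_box c a) => // b; rewrite /= vopS.
case H: ((c == k.+1) ==> ((k.+1 == 1) || (k.+1.-1 \in a))); first by rewrite dop_add_box_comm // E.
(* The case where [dop] and [add_box] do not commute. Adding the box to [a1] merely restores [a],
   which has no part [c.-1], so the remaining operators give zero; both sides are zero. *)
move: H => /negbT; rewrite negb_imply => /andP[/eqP cE]; subst c; case: k E ka {c0 IH} => // k E ka ja.
rewrite /= in ja; rewrite {1}add_boxE // (negbTE ja).
have -> : add_box k.+2 a1 = Some a.
  move: E; rewrite dopE ka => -[<-]; rewrite add_boxE //.
  by rewrite mem_shrink_last_pred // shrink_lastK ?ja.
have := vop_neqNone k.+2 a isT; rewrite /= (negbTE ja); by case: (vop k.+2 a).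
Qed.

(** [dop k.-1] uses up the only part [k.-1], and the later operators act on smaller parts without
    creating it again. *)
Lemma vop_notin k a g : 1 < k -> vop k a = Some g -> mult k.-1 a = 1 -> k.-1 \notin g.
Proof.
case: k => [|[|k]] // _; rewrite vopS // dopE; case: ifP => // ka /= ag m1.
rewrite (vop_mem _ _ ag) // mem_mult; have := mult_shrink_last k.+1 k.+1 a isT ka; lia.
Qed.

(** * Words and the slide *)

Definition word_shape (w : seq nat) : option (seq nat) :=
  foldr (fun c => obind (add_box c)) (Some [::]) w.

Definition shape_of (w : seq nat) : seq nat := odflt [::] (word_shape w).

(** Letters up to [m] suffice: a new box lies at most one column beyond the number of boxes already
    present. *)
Fixpoint words (m : nat) : seq (seq nat) :=
  if m is m'.+1 then
    [seq w <- [seq c :: w | w <- words m', c <- iota 1 m] | word_shape w != None]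
  else [:: [::]].

Definition descent_bits (w : seq nat) : seq bool := if w is c :: w' then pairmap leq c w' else [::].

(* Slides the word [rcons v 1], whose last letter 1 is kept implicit; the second component is
   the column from which the slide removes a box. *)
Fixpoint slide (v : seq nat) : seq nat * nat :=
  if v is c :: v' then
    let p := slide v' in
    if (c == p.2.+1) && (p.2 \notin shape_of p.1) then (p.2 :: p.1, p.2.+1) else (c :: p.1, p.2)
  else ([::], 1).

Lemma add_box_None k g : 1 < k -> k.-1 \notin g -> add_box k g = None.
Proof. by case: k => [|[|k]] // _ kg; rewrite add_boxE // (negbTE kg). Qed.

Lemma add_box_props {c a b} : add_box c a = Some b ->
  [/\ 0 < c, c <= (sumn a).+1, sumn b = (sumn a).+1, is_comp a -> is_comp b & c \in b].
Proof.
case: c => [|[|j]] //; first by case=> <-; rewrite inE.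
rewrite add_boxE //; case: ifP => // ja [<-]; rewrite mem_bump_first_succ //.
elim: a {b} ja => //= x a IH; rewrite inE eq_sym.
have [-> _|xj /IH[_ h1 h2 h3 _]] := altP (x =P j.+1); last first.
  by split=> //=; rewrite /= ?h2; [lia|lia|case/andP=> -> /h3].
by split=> //=; lia.
Qed.

Lemma mem_add_box {c a b} y : add_box c a = Some b -> y \in b -> (y == c) || (y \in a).
Proof.
case: c => [|[|j]] //; first by case=> <-; rewrite inE.
rewrite add_boxE //; case: ifP => // ja [<-]; rewrite !mem_mult.
by have := mult_bump_first y j.+1 a ja; lia.
Qed.

Lemma word_shape_cons c w : word_shape (c :: w) = obind (add_box c) (word_shape w).
Proof. by []. Qed.

Lemma word_shape_cat v w : word_shape (v ++ w) = foldr (fun c => obind (add_box c)) (word_shape w) v.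
Proof. by rewrite /word_shape foldr_cat. Qed.

Lemma word_shape_consP {c w b} : word_shape (c :: w) = Some b ->
  exists2 a, word_shape w = Some a & add_box c a = Some b.
Proof. by rewrite word_shape_cons; case: (word_shape w) => // a; exists a. Qed.

Lemma word_shape_props {w a} : word_shape w = Some a -> sumn a = size w /\ is_comp a.
Proof.
elim: w a => [|c w IH] b; first by case=> <-.
by case/word_shape_consP=> a /IH[h1 h2] /add_box_props[_ _ -> h _]; rewrite h1; split=> //; apply: h.
Qed.

Lemma mem_words m w : (w \in words m) = (size w == m) && (word_shape w != None).
Proof.
elim: m w => [|m IH] w; first by rewrite inE; case: w.
rewrite mem_filter andbC; case E: (word_shape w) => [b|]; last by rewrite !andbF.
rewrite !andbT; apply/allpairsP/idP.
  by case=> -[v c] /= []; rewrite IH => /andP[/eqP <- _] _ ->.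
case: w E => // c w /word_shape_consP[a wa /add_box_props[c0 ca _ _ _]] sw; exists (w, c).
have := (word_shape_props wa).1 => sa.
move: sw; rewrite /= eqSS => sw; split; rewrite ?IH ?wa ?sw ?mem_iota //.
by have := mem_iota 1 m.+1 c; rewrite /= add1n c0 ltnS -(eqP sw) -sa ca => ->.

Qed.

Lemma words_uniq m : uniq (words m).
Proof.
elim: m => // m IH; apply: filter_uniq; apply: allpairs_uniq => //; first exact: iota_uniq.
by move=> [w c] [w' c'] _ _ [-> ->].
Qed.

Arguments words : simpl never.

Lemma descent_bits_cons c v : v != [::] -> descent_bits (c :: v) = (c <= head 0 v) :: descent_bits v.
Proof. by case: v. Qed.

Lemma bump_first_rcons j g k : bump_first j (rcons g k) =
  if j \in g then rcons (bump_first j g) k else rcons g (if k == j then j.+1 else k).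
Proof.
elim: g => /= [|x g ->]; first by case: eqP.
by rewrite inE (eq_sym j x); case: eqP => //= _; case: ifP.
Qed.

Lemma add_box_rcons c g k : 0 < c -> add_box c (rcons g k) =
  if (c == 1) || (c.-1 \in g) then omap (rcons^~ k) (add_box c g)
  else if c == k.+1 then Some (rcons g c) else None.
Proof.
case: c => [|[|j]] // _; rewrite !add_boxE // mem_rcons inE /= bump_first_rcons.
case jg: (j.+1 \in g); rewrite ?orbT /= ?orbF //.
by rewrite eqSS eq_sym; case: eqP => // <-.
Qed.

Lemma add_box_last {c a b} : a != [::] -> add_box c a = Some b ->
  last 0 b = last 0 a \/ [/\ last 0 b = c, last 0 a = c.-1, 1 < c & mult c.-1 a = 1].
Proof.
case/lastP: a => // a k _; case: c => [|c] //; rewrite add_box_rcons //.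
rewrite last_rcons; case: ifP => [_|].
  by case: (add_box c.+1 a) => //= d [<-]; rewrite last_rcons; left.
move/negbT; rewrite negb_or => /andP[c1 kg]; case: eqP => // -[ck] [<-]; subst k; right.
rewrite last_rcons; split=> //; first by case: c c1 {kg}.
by move: kg; rewrite mem_mult /mult -cats1 count_cat /= eqxx addn0; lia.
Qed.

(** The information needed to keep the comparison with the next letter on the left: either the first
    letter stayed and is a part of the new shape, or it was just lowered and the old shape has no
    part [k.-1]. *)
Definition head_inv (v w : seq nat) k (a b : seq nat) :=
  (head 0 w = head 0 v /\ head 0 v \in a) \/
  [/\ head 0 v = k, head 0 w = k.-1, 1 < k & k.-1 \notin b].

(** For [k = p.2], the old shape is [u_k] of the new shape [a]. The last clause turns the comparison
    lost with the final 1 into one between [k] and the last part of [a]; if [a] itself arose from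
    some [u_i], that part is [i]. *)
Lemma slide_spec {v b} : word_shape (rcons v 1) = Some b ->
  let p := slide v in exists a g,
  [/\ [/\ 0 < p.2, size p.1 = size v, word_shape p.1 = Some a, vop p.2 a = Some g & b = rcons g p.2],
      v != [::] -> head_inv v p.1 p.2 a b, descent_bits p.1 = descent_bits v &
      v != [::] -> (last 0 v <= 1) = (p.2 <= last 0 a)].
Proof.
elim: v b => [|c v IH] b; first by case=> <-; exists [::], [::].
rewrite rcons_cons => /word_shape_consP[b1 /IH /=]; case: (slide v) => w k /=.
move=> [a [g [[k0 sz wa ag bE] hd dsE lst]]]; subst b1; rewrite /shape_of wa /= => hup.
have [c0 cb _ _ cinb] := add_box_props hup.
have wv : (w == [::]) = (v == [::]) by rewrite -!size_eq0 sz.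
have aw : (a == [::]) = (v == [::]).
  rewrite -wv -[w == _]size_eq0; have [<-] := word_shape_props wa.
  by case: (a) => [|[|x] a1].
have := vop_neqNone k a k0; rewrite ag /= => /esym kP.
case: ifP => [/andP[/eqP ck ka]|H] /=.
  subst c; have kg : k \notin g by rewrite (vop_mem _ k0 ag).
  move: hup; rewrite add_box_rcons // eqSS (negbTE kg) eqxx orbF.
  rewrite (gtn_eqF k0) => -[bE]; subst b.
  (* The box now added in column [k] is the first one that [vop k.+1] takes off, so [g] stays the
     same. *)
  have := dop_add_boxK k a k0 ka kP; case ha': (add_box k a) => [a'|] //= da'.
  exists a', g; split.
  - by rewrite sz wa vopS // da'.
  - by right; split; rewrite //= mem_rcons inE negb_or kg andbT; lia.
  - case v0: (v == [::]); first by move: wv; rewrite v0 => /eqP ->; rewrite (eqP v0).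
    rewrite -[LHS]/(descent_bits (k :: w)) -[RHS]/(descent_bits (k.+1 :: v)) !descent_bits_cons ?wv ?v0 // dsE.
    (* Replacing [k.+1] by [k] matters only against a letter [k]. An unchanged head is a part of
       [a], hence not [k]; a head lowered from [k] to [k.-1] is smaller than its left neighbour
       before and after. *)
    congr cons; have [[-> hv]|[-> -> _ _]] := hd (negbT v0); last by lia.
    by rewrite leq_eqVlt; case: eqP hv ka => // <- ->.
  - move=> _; case v0: (v == [::]).
      move: ha' kP; move: aw; rewrite v0 => /eqP ->; rewrite (eqP v0) /= orbF => + /eqP kk.
      by rewrite kk => -[<-].
    rewrite -[last _ _]/(last k.+1 v); have -> : last k.+1 v = last 0 v by case: (v) v0.
    rewrite lst ?v0 //; have a0 : a != [::] by rewrite aw v0.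
    have la : last 0 a \in a by case: (a) a0 => //= x s _; rewrite mem_last.
    have [->|[-> -> k1 _]] := add_box_last a0 ha'; last by lia.
    by rewrite leq_eqVlt; case: eqP la ka => // <- ->.
(* The box cannot land on the final part [k]: this would need [c = k.+1] and no part [k] in [g],
   hence none in [a], which is the previous case. *)
have [g' cg bE] : exists2 g', add_box c g = Some g' & b = rcons g' k.
  move: hup; rewrite add_box_rcons //; case: ifP => [_|].
    by case: (add_box c g) => // g' [<-]; exists g'.
  move/negbT; rewrite negb_or => /andP[_]; case: eqP => // ck; subst c.
  by rewrite (vop_mem _ k0 ag) //=; move: H; rewrite eqxx /= => ->.
subst b; have := vop_add_box c k0 c0 ag; rewrite cg.
case ca: (add_box c a) => [a'|] //= ag'.
exists a', g'; split.
- by rewrite sz wa.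
- by move=> _; left; split=> //; have [] := add_box_props ca.
- case v0: (v == [::]); first by move: wv; rewrite v0 => /eqP ->; rewrite (eqP v0).
  rewrite -[LHS]/(descent_bits (c :: w)) -[RHS]/(descent_bits (c :: v)) !descent_bits_cons ?wv ?v0 // dsE.
  (* When the head drops from [k] to [k.-1], only [c = k] would change the comparison, but [g] has
     no part [k.-1] to enlarge. *)
  congr cons; have [[-> hv //]|[-> -> k1]] := hd (negbT v0).
  rewrite mem_rcons inE negb_or => /andP[_ kg]; suff : c != k by lia.
  by apply/eqP => ck; move: cg; rewrite ck add_box_None.
- move=> _; case v0: (v == [::]).
    move: ca kP; move: aw; rewrite v0 => /eqP ->; rewrite (eqP v0) /= orbF => + /eqP ->.
    by case: (c) => [|[|c']] //= [<-].
  rewrite -[last _ _]/(last c v); have -> : last c v = last 0 v by case: (v) v0.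
  rewrite lst ?v0 //; have a0 : a != [::] by rewrite aw v0.
  (* If the last part changes, only [c = k] matters: then [a] has a single part [k.-1], which
     [vop k] uses up, so column [k] is closed for [g]. *)
  have [->|[-> -> k1 m1]] := add_box_last a0 ca; first by [].
  suff : c != k by lia.
  apply/eqP => ck; subst c; have kg := vop_notin k a g k1 ag m1.
  by move: cg; rewrite add_box_None.
Qed.

(** The inverse reads from the left: the first letter [c] was lowered from [c.+1] exactly when
    [k = c.+1] and the shape of the remaining letters has no part [c]. *)
Lemma slide_surj {w k a g} : word_shape w = Some a -> 0 < k -> vop k a = Some g ->
  exists2 v, slide v = (w, k) & word_shape (rcons v 1) = Some (rcons g k).
Proof.
elim: w k a g => [|c w IH] k a g.
  case=> <- k0 ag; have := vop_neqNone k [::] k0; rewrite ag /= orbF => /esym/eqP k1.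
  by subst k; case: ag => <-; exists [::].
move=> /word_shape_consP[a1 wa1 ca] k0 ag; have [c0 _ _ _ _] := add_box_props ca.
have := vop_neqNone k a k0; rewrite ag /= => /esym kP.
case H: ((k == c.+1) && (c \notin a1)).
  case/andP: H => /eqP kc ca1; subst k.
  have cP : (c == 1) || (c.-1 \in a1).
    by case: c ca {kP k0 ca1 ag c0} => [|[|c]] //; rewrite add_boxE //; case: ifP => // ->.
  have := dop_add_boxK c a1 c0 ca1 cP; rewrite ca /= => da.
  move: (ag); rewrite vopS // da /= => a1g; have [v sv shv] := IH c a1 g wa1 c0 a1g.
  exists (c.+1 :: v); first by rewrite /= sv /= /shape_of wa1 /= eqxx ca1.
  rewrite rcons_cons word_shape_cons shv /obind /oapp add_box_rcons // eqxx orbC /= (vop_mem c c0 a1g) //.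
  by rewrite (negbTE ca1) eqSS; case: (c) c0.
have ka1 : (k == 1) || (k.-1 \in a1).
  case: (eqVneq k 1) kP => //= k1 /(mem_add_box _ ca); case/orP => // /eqP kc; move: H.
  by have -> : (k == c.+1) by [lia]; rewrite -kc => /negbFE.
have := vop_neqNone k a1 k0; rewrite ka1; case a1g: (vop k a1) => [g1|] // _.
have [v sv shv] := IH k a1 g1 wa1 k0 a1g.
have cg : add_box c g1 = Some g by rewrite -(vop_add_box c k0 c0 a1g) ca.
have cP : (c == 1) || (c.-1 \in g1).
  by move: cg c0; case: (c) => [|[|c']] //; rewrite add_boxE //; case: ifP => // ->.
have ck : (c == k.+1) ==> (k \in a1).
  apply/implyP => /eqP ckE; move: cP; rewrite ckE /= (vop_mem k k0 a1g) //.
  by case/orP => //; lia.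
exists (c :: v).
  by rewrite /= sv /shape_of wa1 /=; case: eqP ck => //= _ ->.
by rewrite rcons_cons word_shape_cons shv /obind /oapp add_box_rcons // cP cg.
Qed.

(** Equal outputs come from equal treatment of the first letter: lowering yields an index [i.+1]
    with no part [i] in the remaining shape, while no lowering needs [vop i.+1] to be nonzero on
    that shape. *)
Lemma slide_inj v1 v2 : word_shape (rcons v1 1) -> word_shape (rcons v2 1) ->
  slide v1 = slide v2 -> v1 = v2.
Proof.
have size_slide v : size (slide v).1 = size v.
  by elim: v => //= c v; case: ifP => _ /= ->.
elim: v1 v2 => [|c1 v1 IH] [|c2 v2] //.
- by move=> _ _ /(congr1 (fun p => size p.1)); rewrite !size_slide.
- by move=> _ _ /(congr1 (fun p => size p.1)); rewrite !size_slide.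
rewrite !rcons_cons; case E1: (word_shape (c1 :: _)) => [b1|] // _.
case E2: (word_shape (c2 :: _)) => [b2|] // _.
have [d1 H1 _] := word_shape_consP E1; have [d2 H2 _] := word_shape_consP E2.
have [a1 [g1 [[k1 _ wa1 ag1 _] _ _ _]]] := slide_spec H1.
have [a2 [g2 [[k2 _ wa2 ag2 _] _ _ _]]] := slide_spec H2.
move: (IH v2); rewrite H1 H2 => /(_ isT isT) {}IH.
move: IH k1 wa1 ag1 k2 wa2 ag2 => /=; case: (slide v1) => w1 i1; case: (slide v2) => w2 i2 /=.
move=> IH k1 wa1 ag1 k2 wa2 ag2; rewrite /shape_of wa1 wa2 /=.
have excl i a1' a2' : 0 < i -> a1' = a2' -> i \notin a1' -> vop i.+1 a2' = None.
  move=> i0 <- ia; have := vop_neqNone i.+1 a1' isT; rewrite /= (negbTE ia) orbF.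
  by case: (vop _ _) => //= ? /esym; lia.
case: ifP => [/andP[/eqP e1 n1]|_]; case: ifP => [/andP[/eqP e2 n2]|_].
- by case=> ei ew; rewrite e1 e2 ei IH // ew ei.
- case=> ei ew ek; subst; have aa : a1 = a2 by move: wa1; rewrite wa2 => -[].
  by move: ag2; rewrite (excl _ _ _ k1 aa n1).
- case=> ei ew ek; subst; have aa : a2 = a1 by move: wa1; rewrite wa2 => -[].
  by move: ag1; rewrite (excl _ _ _ k2 aa n2).
- by case=> ei ew ek; rewrite ei IH // ew ek.
Qed.

Lemma word_shape_last {w b} : word_shape w = Some b -> w != [::] -> exists v, w = rcons v 1.
Proof.
case/lastP: w => // v x; rewrite -cats1 word_shape_cat => H _; exists v; rewrite cats1.
congr rcons; case: x H => [|[|x]] // H; exfalso; move: H; rewrite /=.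
all: by have -> : foldr (fun c => obind (add_box c)) None v = None by elim: v => //= c v ->.
Qed.

Lemma leq_sumn_mem x (s : seq nat) : x \in s -> x <= sumn s.
Proof. by elim: s => //= y s IH; rewrite inE => /orP[/eqP ->|/IH]; lia. Qed.

Definition unrcons (u : seq nat) := take (size u).-1 u.

Lemma unrcons_rcons v x : unrcons (rcons v x) = v.
Proof. by rewrite /unrcons size_rcons /= -cats1 take_size_cat. Qed.

(** The bijection in the form that reindexes a sum. Indices up to [M.+1] suffice, as a nonzero [u_i]
    needs [i = 1] or a part [i.-1]. *)
Lemma perm_slide M :
  perm_eq [seq slide (unrcons u) | u <- words M.+1]
          [seq p <- [seq (w, i) | w <- words M, i <- iota 1 M.+1] | uop p.2 (shape_of p.1) != None].
Proof.
have wordsP u : u \in words M.+1 -> exists v b, [/\ u = rcons v 1, size v = M & word_shape u = Some b].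
  rewrite mem_words => /andP[/eqP us]; case E: (word_shape u) => [b|] // _.
  have [|v uv] := word_shape_last E; first by rewrite -size_eq0 us.
  by exists v, b; split=> //; move: us; rewrite uv size_rcons => -[].
apply: uniq_perm.
- rewrite map_inj_in_uniq ?words_uniq // => u1 u2 /wordsP[v1 [b1 [-> _ h1]]] /wordsP[v2 [b2 [-> _ h2]]].
  by rewrite !unrcons_rcons => /slide_inj ->; rewrite ?h1 ?h2.
- apply: filter_uniq; apply: allpairs_uniq; rewrite ?words_uniq ?iota_uniq //.
  by move=> [w c] [w' c'] _ _ [-> ->].
move=> [w k]; rewrite mem_filter; apply/mapP/andP.
  case=> u /wordsP[v [b [-> sv h]]]; rewrite unrcons_rcons.
  have [a [g [[k0 sz wa ag bE] _ _ _]]] := slide_spec h.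
  move=> E; rewrite -E /= in k0 sz wa ag; split; first by rewrite /= /shape_of wa /uop /= ag.
  apply/allpairsP; exists (w, k); split=> //; first by rewrite mem_words wa sz sv eqxx.
  rewrite mem_iota k0 add1n ltnS.
  have := vop_neqNone k a k0; rewrite ag /= => /esym/orP[/eqP -> //|ka].
  have [sa _] := word_shape_props wa; rewrite -sv -sz -sa.
  by have := leq_sumn_mem _ _ ka; case: (k) k0.
move=> [+ /allpairsP[[w1 k1] [+ + E]]]; move: E => [<- <-].
rewrite mem_words mem_iota => + /andP[/eqP sw] + /andP[k0 _]; rewrite /shape_of /= in sw k0 *.
case wa: (word_shape w) => [a|] //= + _; rewrite /uop; case ag: (vop k a) => [g|] // _.
have [v sv shv] := slide_surj wa k0 ag; exists (rcons v 1); last by rewrite unrcons_rcons sv.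
have [a' [g' [[_ sz _ _ _] _ _ _]]] := slide_spec shv.
by rewrite mem_words shv size_rcons -sz sv /= sw eqxx.
Qed.

(** * Sequences of operators *)

Lemma sumn_shrink_last k a : 0 < k -> k \in a -> (sumn (shrink_last k a)).+1 = sumn a.
Proof.
move=> k0; elim: a => //= x a IH; rewrite inE (eq_sym k x).
case: ifP => [ka _|ka] /=; first by rewrite -(IH ka); lia.
by rewrite orbF => /eqP ->; rewrite eqxx; case: eqP => [->|_] //=; lia.
Qed.

Lemma sumn_vop {k a g} : 0 < k -> vop k a = Some g -> sumn g + k = (sumn a).+1.
Proof.
case: k => // k _; elim: k a => [|k IH] a; first by case=> <-; rewrite addn1.
rewrite vopS // dopE; case: ifP => // ka /= /IH; have := sumn_shrink_last k.+1 a isT ka; lia.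
Qed.

Lemma uop_props {i a b} : 0 < i -> uop i a = Some b ->
  [/\ i <= (sumn a).+1, sumn b = (sumn a).+1 & last 0 b = i].
Proof.
rewrite /uop => i0; case ag: (vop i a) => [g|] // [<-]; have := sumn_vop i0 ag.
by rewrite last_rcons sumn_rcons; split=> //; lia.
Qed.

Lemma uapp_rcons x i a : uapp (rcons x i) a = obind (uop i) (uapp x a).
Proof. by rewrite /uapp foldl_rcons. Qed.

(** The last part records the last index used, so the condition on the next index can be read from
    the shape alone. *)
Lemma uapp_props {x a b} : all (fun i => 0 < i) x -> uapp x a = Some b ->
  sumn b = sumn a + size x /\ (x != [::] -> last 0 b = last 0 x).
Proof.
elim/last_ind: x b => [|x i IH] b; first by move=> _ [<-]; rewrite addn0.
rewrite all_rcons uapp_rcons => /andP[i0 x0]; case E: (uapp x a) => [c|] //=.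
by have [h _] := IH c x0 E; case/(uop_props i0); rewrite last_rcons size_rcons h addnS.
Qed.

(* e = false gives increasing sequences, e = true weakly decreasing ones *)
Definition strip_rel (e : bool) (i j : nat) := (j <= i) == e.

Definition strip_step (e : bool) (n : nat) (a : seq nat) (L : seq (seq nat)) :=
  [seq rcons p.1 p.2 |
     p <- [seq (x, i) | x <- L, i <- iota 1 (sumn a + n)%N.+1] &
     ((n == 0) || strip_rel e (last 0 p.1) p.2) && (obind (uop p.2) (uapp p.1 a) != None)].

Fixpoint strips (e : bool) (n : nat) (a : seq nat) : seq (seq nat) :=
  if n is n'.+1 then strip_step e n' a (strips e n' a) else [:: [::]].

Lemma sorted_rcons_last (T : Type) (r : rel T) x0 s i : sorted r (rcons s i) =
  (nilp s || r (last x0 s) i) && sorted r s.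
Proof. by case: s => //= x s; rewrite rcons_path andbC. Qed.

Lemma mem_strips e n a x : (x \in strips e n a) =
  [&& size x == n, all (fun i => 0 < i) x, sorted (strip_rel e) x & uapp x a != None].
Proof.
elim: n x => [|n IH] x; first by rewrite inE; case: x.
apply/mapP/and4P.
  case=> -[y i]; rewrite mem_filter => /andP[/andP[h1 h2] /allpairsP[[y' i'] [+ + E]]] ->.
  move: E h1 h2 => [<- <-]; rewrite IH mem_iota => h1 h2 /and4P[/eqP sy y0 ys _] /andP[i0 _].
  rewrite size_rcons sy all_rcons uapp_rcons (sorted_rcons_last _ _ 0) /nilp sy h1.
  by rewrite /= in i0; split=> //; apply/andP.
case/lastP: x => [[] | y i []] //; rewrite size_rcons all_rcons uapp_rcons (sorted_rcons_last _ _ 0).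
rewrite eqSS /nilp => sy /andP[i0 y0]; rewrite (eqP sy) => /andP[h ys] h2.
exists (y, i) => //; rewrite mem_filter; apply/andP; split; first by rewrite /= h h2.
 apply/allpairsP; exists (y, i).
split=> //; first by rewrite IH sy y0 ys; case: (uapp y a) h2.
rewrite mem_iota i0 /=; case E: (uapp y a) h2 => [b|] //= h2.
have [sb _] := uapp_props y0 E; case E': (uop i b) h2 => [c|] // _.
by have [+ _ _] := uop_props i0 E'; rewrite sb (eqP sy) add1n ltnS.
Qed.

Lemma strips_uniq e n a : uniq (strips e n a).
Proof.
elim: n => //= n IH; rewrite /strip_step map_inj_uniq; last by move=> [x i] [y j] /= /rcons_inj[-> ->].
apply: filter_uniq; apply: allpairs_uniq => //; first exact: iota_uniq.
by move=> [w c] [w' c'] _ _ [-> ->].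
Qed.

Lemma size_descent_bits w : size (descent_bits w) = (size w).-1.
Proof. by case: w => //= c w; rewrite size_pairmap. Qed.

Lemma descent_bits_rcons v x : v != [::] -> descent_bits (rcons v x) = rcons (descent_bits v) (last 0 v <= x).
Proof. by case: v => //= c v _; rewrite -!cats1 pairmap_cat. Qed.

(** * Tableaux and words *)

Definition incr_head (s : seq nat) := if s is x :: s' then x.+1 :: s' else [::].

(** A true bit separates two parts, so [n] bits encode a composition of [n.+1]; the empty
    composition has no code and is treated apart. *)
Fixpoint comp_of_bits (bs : seq bool) : seq nat :=
  if bs is b :: bs' then if b then 1 :: comp_of_bits bs' else incr_head (comp_of_bits bs') else [:: 1].

Definition descent_comp (w : seq nat) := if w is [::] then [::] else comp_of_bits (descent_bits w).

Definition triple_ok (r s : seq nat) : bool :=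
  all (fun c => (c.+1 < size s) ==> ((nth 0 s c.+1 < nth 0 r c) ==>
         ((c.+1 < size r) && (nth 0 s c.+1 < nth 0 r c.+1)))) (iota 0 (size s)).

Lemma triple_okP r s : reflect (forall c, c.+1 < size s -> nth 0 s c.+1 < nth 0 r c ->
    c.+1 < size r /\ nth 0 s c.+1 < nth 0 r c.+1) (triple_ok r s).
Proof.
apply: (iffP allP) => [H c cs h|H c _].
  by have := H c; rewrite mem_iota add0n (ltnW cs) cs h => /(_ isT)/andP.
by apply/implyP => cs; apply/implyP => h; apply/andP; exact: H.
Qed.

Lemma triple_ruleE t : triple_rule t = pairwise triple_ok t.
Proof.
apply/idP/(pairwiseP [::]) => [/allP H i j it jt ij | H].
  have /H/allP/(_ j) : i \in iota 0 (size t) by rewrite mem_iota.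
  by rewrite mem_iota ij => /(_ jt).
apply/allP => i; rewrite mem_iota => /andP[_ it]; apply/allP => j; rewrite mem_iota => /andP[_ jt].
by apply/implyP => ij; apply: H.
Qed.

(** * Adding the smallest entry to a tableau *)

Lemma nth_gt0_lt (s : seq nat) c y : y < nth 0 s c -> c < size s.
Proof. by case: (ltnP c (size s)) => // h; rewrite nth_default. Qed.

(** The only new instance concerns the cell of [x]. As [x] is below all entries of [a], it says that
    [a] is longer than [s] once it is at least as long. *)
Lemma triple_ok_rconsr a s x : s != [::] -> all (ltn x) a ->
  triple_ok a (rcons s x) = triple_ok a s && (size a != size s).
Proof.
move=> s0 /(all_nthP 0) xa; apply/triple_okP/andP => [H|[/triple_okP H sz] c].
  split.
    apply/triple_okP => c cs h; have := H c; rewrite size_rcons nth_rcons cs.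
    by apply=> //; apply: ltnW.
  apply/negP => /eqP sz; have := H (size s).-1.
  have s1 : (size s).-1.+1 = size s by case: (s) s0.
  rewrite s1 size_rcons nth_rcons ltnn eqxx sz ltnn => /(_ (ltnSn _)).
  by case=> //; apply: xa; rewrite sz -s1.
rewrite size_rcons ltnS nth_rcons => cs; have [cs'|cs'] := ltnP c.+1 (size s); first exact: H.
have cE : c.+1 = size s by apply/eqP; rewrite eqn_leq cs cs'.
rewrite cE eqxx => /nth_gt0_lt ca; suff ca' : size s < size a by split=> //; exact: xa.
by move: ca; rewrite cE leq_eqVlt eq_sym (negbTE sz).
Qed.

Lemma triple_ok_rconsl r b x : all (ltn x) b -> triple_ok (rcons r x) b = triple_ok r b.
Proof.
move=> /(all_nthP 0) xb; apply/triple_okP/triple_okP => H c cb h.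
  have cr := nth_gt0_lt _ _ _ h; have := H c cb; rewrite nth_rcons cr => /(_ h) [].
  rewrite size_rcons nth_rcons ltnS; case: (ltnP c.+1 (size r)) => // h1 _ h2; exfalso.
  have xc : x < nth 0 b c.+1 := xb _ cb; move: h2; case: eqP => _; last by rewrite ltn0.
  by rewrite ltnNge ltnW.
have cr := nth_gt0_lt _ _ _ h; move: cr cb h; rewrite size_rcons ltnS leq_eqVlt => /orP[/eqP ->|cr] cb.
  by rewrite nth_rcons ltnn eqxx => h; have xc : x < nth 0 b (size r).+1 := xb _ cb; move: h; rewrite ltnNge ltnW.
by rewrite !nth_rcons cr => /(H c cb)[h1 h2]; rewrite h1 ltnS ltnW.
Qed.

Definition good_tableau (t : seq (seq nat)) : bool :=
  [&& all (sorted gtn) t, [::] \notin t, sorted ltn (map (head 0) t) & triple_rule t].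

Lemma sorted_gtn_rcons s x : all (ltn x) s -> sorted gtn (rcons s x) = sorted gtn s.
Proof.
case: s => //= y s /andP[xy xs]; rewrite rcons_path /=.
have -> : x < last y s by have := mem_last y s; rewrite inE => /orP[/eqP -> //|/(allP xs)].
by rewrite andbT.
Qed.

(** No higher row may have the length of [s]: the box goes to the leftmost part of its size, as in
    [bump_first]. *)
Lemma good_tableau_rcons A s B x : s != [::] -> all (ltn x) (flatten (A ++ s :: B)) ->
  good_tableau (A ++ rcons s x :: B) = good_tableau (A ++ s :: B) && (size s \notin map size A).
Proof.
rewrite flatten_cat /= !all_cat => s0 /and3P[xA xs xB].
have xA' a : a \in A -> all (ltn x) a.
  by move=> aA; apply/allP => y ya; apply: (allP xA); apply/flattenP; exists a.
have xB' b : b \in B -> all (ltn x) b.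
  by move=> aB; apply/allP => y ya; apply: (allP xB); apply/flattenP; exists b.
rewrite /good_tableau !triple_ruleE !all_cat /= sorted_gtn_rcons // !mem_cat !inE.
have -> : ([::] == rcons s x) = ([::] == s) by case: (s) s0.
have -> : map (head 0) (A ++ rcons s x :: B) = map (head 0) (A ++ s :: B).
  by rewrite !map_cat /=; case: (s) s0.
rewrite !pairwise_cat /= !allrel_consr -!andbA.
have -> : all (triple_ok^~ (rcons s x)) A = all (triple_ok^~ s) A && (size s \notin map size A).
  elim: A xA' {xA} => //= a A IH xA'; rewrite IH; last by move=> b bA; apply: xA'; rewrite inE bA orbT.
  rewrite triple_ok_rconsr //; last by apply: xA'; rewrite mem_head.
  by rewrite inE negb_or eq_sym -!andbA; do ?bool_congr.
have -> : all (triple_ok (rcons s x)) B = all (triple_ok s) B.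
  by apply: eq_in_all => b bB; rewrite triple_ok_rconsl ?xB'.
by rewrite -!andbA; do ?bool_congr.
Qed.

Lemma good_tableau_cons x t : all (ltn x) (flatten t) -> good_tableau ([:: x] :: t) = good_tableau t.
Proof.
move=> xt; rewrite /good_tableau !triple_ruleE /= inE /=.
have -> : all (triple_ok [:: x]) t.
  apply/allP => r rt; rewrite (triple_ok_rconsl [::]); first by apply/triple_okP => c _; rewrite nth_nil.
  by apply/allP => y ya; apply: (allP xt); apply/flattenP; exists r.
case n0: ([::] \notin t) => //=.
suff -> : path ltn x (map (head 0) t) = sorted ltn (map (head 0) t) by [].
case: t n0 xt => //= r t; rewrite inE negb_or => /andP[r0 _].
by case: r r0 => //= y r _ /andP[->].
Qed.

Fixpoint insert_row (j x : nat) (t : seq (seq nat)) : seq (seq nat) :=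
  if t is r :: t' then if size r == j then rcons r x :: t' else r :: insert_row j x t' else [::].

Definition insert_box (c x : nat) (t : seq (seq nat)) :=
  if c == 1 then [:: x] :: t else insert_row c.-1 x t.

Fixpoint tableau_of (e : nat) (w : seq nat) : seq (seq nat) :=
  if w is c :: w' then insert_box c e (tableau_of e.+1 w') else [::].

Lemma insert_row_cat A s B x : size s \notin map size A ->
  insert_row (size s) x (A ++ s :: B) = A ++ rcons s x :: B.
Proof.
elim: A => /= [|r A IH]; first by rewrite eqxx.
by rewrite inE negb_or eq_sym => /andP[/negbTE -> /IH ->].
Qed.

Lemma size_split j (t : seq (seq nat)) : j \in map size t ->
  exists A s B, [/\ t = A ++ s :: B, size s = j & j \notin map size A].
Proof.
elim: t => //= r t IH; rewrite inE; case: (eqVneq j (size r)) => [-> _|jr /= /IH].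
  by exists [::], r, t.
by case=> A [s [B [-> sj jA]]]; exists (r :: A), s, B; rewrite /= inE negb_or jr.
Qed.

Lemma map_size_insert_box c x t b : add_box c (map size t) = Some b -> map size (insert_box c x t) = b.
Proof.
case: c => [|[|j]] //; first by case=> <-.
rewrite add_boxE //; case: ifP => // jt [<-]; rewrite /insert_box /=.
have [A [s [B [-> sj jA]]]] := size_split _ _ jt.
rewrite -sj insert_row_cat ?sj // !map_cat /= size_rcons sj.
by elim: A jA {jt} => /= [|r A IH]; rewrite ?eqxx // inE negb_or eq_sym => /andP[/negbTE -> /IH <-].
Qed.

Lemma perm_insert_box c x t b : add_box c (map size t) = Some b ->
  perm_eq (flatten (insert_box c x t)) (x :: flatten t).
Proof.
case: c => [|[|j]] //; rewrite add_boxE //; case: ifP => // jt _; rewrite /insert_box /=.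
have [A [s [B [-> sj jA]]]] := size_split _ _ jt.
rewrite -sj insert_row_cat ?sj // !flatten_cat /= cat_rcons.
by apply/permP => p; rewrite /= !count_cat /= !(addnCA (p x)).
Qed.

Lemma tableau_of_good e w a : word_shape w = Some a ->
  [/\ map size (tableau_of e w) = a, perm_eq (flatten (tableau_of e w)) (iota e (size w)) &
      good_tableau (tableau_of e w)].
Proof.
elim: w e a => [|c w IH] e a; first by case=> <-.
case/word_shape_consP=> b /(IH e.+1)[sb pb gb] ca; rewrite /=.
rewrite -sb in ca; split; first exact: map_size_insert_box.
  by rewrite (permPl (perm_insert_box _ _ _ _ ca)) perm_cons.
have et : all (ltn e) (flatten (tableau_of e.+1 w)).
  by apply/allP => y; rewrite (perm_mem pb) mem_iota => /andP[].
case: c ca => [|[|j]] //; first by rewrite /insert_box /= good_tableau_cons.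
rewrite add_boxE //; case: ifP => // jt _; rewrite /insert_box /=.
have [A [s [B [tE sj jA]]]] := size_split _ _ jt.
move: gb et; rewrite tE => gb et; rewrite -sj insert_row_cat ?sj // good_tableau_rcons //.
  by rewrite gb sj.
by rewrite -size_eq0 sj.
Qed.

(** The smallest entry [e] ends its row and is removed. If it is alone there, the row is the top one
    because the first column increases; otherwise [good_tableau_rcons] makes its row the topmost of
    that length. *)
Lemma tableau_of_surj e m t : good_tableau t -> perm_eq (flatten t) (iota e m) ->
  exists2 w, word_shape w = Some (map size t) & tableau_of e w = t.
Proof.
elim: m e t => [|m IH] e t gt.
  move/perm_nilP; case: t gt => [|r t]; first by exists [::].
  by case/and4P => _ + _ _; rewrite inE negb_or; case: r.
move=> pt; have : e \in flatten t by rewrite (perm_mem pt) mem_head.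
case/flattenP => r /(nthP [::])[i it ri] er.
have tE : t = take i t ++ r :: drop i.+1 t by rewrite -ri -drop_nth // cat_take_drop.
move: (take i t) (drop i.+1 t) tE => A B tE {i it ri}; subst t.
have ge_e y : y \in flatten (A ++ r :: B) -> e <= y by rewrite (perm_mem pt) mem_iota => /andP[].
have [s rE] : exists s, r = rcons s e.
  case/and4P: (gt) => /allP/(_ r) + _ _ _; rewrite mem_cat mem_head orbT => /(_ isT).
  case/lastP: r {pt gt} er ge_e => // s x; rewrite mem_rcons inE => /predU1P[-> _ _|es ge_e]; first by exists s.
  rewrite sorted_pairwise; last by move=> y z w /= h1 h2; apply: ltn_trans h1.
  rewrite pairwise_rcons => /andP[/allP/(_ _ es) /= xe _]; have := ge_e x.
  by rewrite leqNgt xe flatten_cat /= mem_cat mem_cat mem_rcons mem_head !orbT => /(_ isT).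
subst r; have pe : perm_eq (flatten (A ++ s :: B)) (iota e.+1 m).
  rewrite -(perm_cons e) -[e :: iota _ _]/(iota e m.+1) -(permPr pt) !flatten_cat /= cat_rcons.
  by apply/permP => p; rewrite /= !count_cat /= !(addnCA (p e)).
have et : all (ltn e) (flatten (A ++ s :: B)).
  by apply/allP => y; rewrite (perm_mem pe) mem_iota => /andP[].
case s0: (s == [::]).
  move: et pe gt; rewrite (eqP s0); case: A {pt er} ge_e => [_|a A ge_e].
    rewrite [flatten _]/= => et pe; rewrite [good_tableau _]good_tableau_cons // => gB.
    have [w wB tw] := IH e.+1 B gB pe; exists (1 :: w); first by rewrite word_shape_cons wB.
    by rewrite /= tw.
  move=> _ _ /and4P[_ + + _]; rewrite !inE negb_or => /andP[a0 _] /=.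
  move/(order_path_min ltn_trans)/allP/(_ e); rewrite map_cat mem_cat mem_head orbT => /(_ isT).
  rewrite ltnNge ge_e // flatten_cat /=; case: (a) a0 => //= y a' _; exact: mem_head.
move: gt; rewrite good_tableau_rcons ?s0 // => /andP[gt sA].
have [w wB tw] := IH e.+1 _ gt pe; exists ((size s).+1 :: w).
  case E: (add_box (size s).+1 (map size (A ++ s :: B))) => [b|].
    rewrite word_shape_cons wB /obind /oapp E -(map_size_insert_box _ e _ _ E).
    by rewrite /insert_box eqSS size_eq0 s0 insert_row_cat.
  by move: E; rewrite add_boxE ?lt0n ?size_eq0 ?s0 // map_cat mem_cat mem_head orbT.
by rewrite /= tw /insert_box eqSS size_eq0 s0 /= insert_row_cat.
Qed.

Lemma colof_cons r t v : colof (r :: t) v = if v \in r then index v r else colof t v.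
Proof. by rewrite /colof /=; case: ifP. Qed.

Lemma colof_insert_box c x t b v : add_box c (map size t) = Some b -> x \notin flatten t ->
  colof (insert_box c x t) v = if v == x then c.-1 else colof t v.
Proof.
case: c => [|[|j]] //.
  by move=> _ _; rewrite /insert_box /= colof_cons inE; case: eqP => // ->; rewrite /= eqxx.
rewrite add_boxE //; case: ifP => // + _; rewrite /insert_box /=.
elim: t => //= r t IH; rewrite inE mem_cat negb_or (eq_sym j.+1).
case: eqP => [sr _ /andP[xr xt]|_ /= jt /andP[xr xt]]; rewrite !colof_cons; last first.
  by rewrite IH //; case: eqP => // ->; rewrite (negbTE xr).
rewrite mem_rcons inE; case: eqP => [-> | vx] /=.
  by rewrite -cats1 index_cat (negbTE xr) /= eqxx addn0.
by case: ifP => // vr; rewrite -cats1 index_cat vr.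
Qed.

Lemma colof_tableau_of e w a i : word_shape w = Some a -> i < size w ->
  (colof (tableau_of e w) (e + i)).+1 = nth 0 w i.
Proof.
elim: w e a i => // c w IH e a i /word_shape_consP[b wb ca] /= iw.
have [sb pb _] := tableau_of_good e.+1 w b wb; have [c0 _ _ _ _] := add_box_props ca.
rewrite -sb in ca; rewrite (colof_insert_box _ _ _ _ _ ca); last first.
  by rewrite (perm_mem pb) mem_iota ltnn.
case: i iw => [|i] iw; first by rewrite addn0 eqxx prednK.
rewrite -[X in _ == X]addn0 eqn_add2l /= addnS -addSn; exact: IH wb iw.
Qed.

Lemma comp_of_bits_cons bs : exists x s, comp_of_bits bs = x.+1 :: s.
Proof. by elim: bs => [|[] bs [x [s /= ->]]]; [exists 0, [::] | exists 0, (x.+1 :: s) | exists x.+1, s]. Qed.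

(** The offset [p] serves the induction: [c] is the letter of the entry [p.+1], and the first
    difference is taken from [p]. *)
Lemma pairmap_descents p c w :
  pairmap (fun a b => b - a) p
    (rcons [seq j <- iota p.+1 (size w) | nth 0 (c :: w) (j - p.+1) <= nth 0 (c :: w) (j - p)]
           (p.+1 + size w)) = comp_of_bits (pairmap leq c w).
Proof.
elim: w c p => [|y w IH] c p; first by rewrite /= addn0 subSnn.
have E : [seq j <- iota p.+1 (size (y :: w)) |
            nth 0 [:: c, y & w] (j - p.+1) <= nth 0 [:: c, y & w] (j - p)] =
         (if c <= y then [:: p.+1] else [::]) ++
         [seq j <- iota p.+2 (size w) | nth 0 (y :: w) (j - p.+2) <= nth 0 (y :: w) (j - p.+1)].
  rewrite /= subnn subSnn /=.
  have -> : forall b (x : nat) s, (if b then x :: s else s) = (if b then [:: x] else [::]) ++ s by case.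
  congr cat; apply: eq_in_filter => j; rewrite mem_iota => /andP[pj _].
  by have -> : j - p = (j - p.+2).+2 by [lia]; have -> : j - p.+1 = (j - p.+2).+1 by [lia].
rewrite E rcons_cat [size (_ :: _)]/= addnS -addSn [pairmap leq _ _]/= [comp_of_bits _]/=.
case: (c <= y) => /=; first by rewrite IH subSnn.
(* Without a descent at [p.+1], the first difference starts at [p] rather than [p.+1] and is one
   larger, which is [incr_head]. *)
rewrite -(IH y p.+1); set s := rcons _ _.
have : all (leq p.+1) s.
  rewrite all_rcons; apply/andP; split; first by lia.
  by apply/allP => j; rewrite mem_filter mem_iota => /and3P[_ h _]; apply: ltnW.
by case: s => //= z s /andP[pz _]; rewrite subnSK.
Qed.

Lemma descomp_tableau_of w a : word_shape w = Some a -> descomp (tableau_of 1 w) = descent_comp w.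
Proof.
case: w => // c w wa; have [_ pw _] := tableau_of_good 1 _ _ wa.
rewrite /descomp (perm_size pw) size_iota /= -[comp_of_bits _](pairmap_descents 0).
congr (pairmap _ _ (rcons _ _)); apply: eq_in_filter => j; rewrite mem_iota add1n => /andP[j0 jw].
rewrite -ltnS.
have := colof_tableau_of 1 _ _ j.-1 wa; have := colof_tableau_of 1 _ _ j wa; rewrite /= !add1n.
move=> -> //; rewrite prednK // => ->; last by move: jw => /=; lia.
by rewrite subn0 subn1.
Qed.

(** * Counting tableaux by words *)

Lemma reshape_inj_permutations al : {in permutations (iota 1 (sumn al)) &, injective (reshape al)}.
Proof.
move=> p q; rewrite !mem_permutations => /perm_size ps /perm_size qs /(congr1 flatten).
by rewrite !reshapeKr ?ps ?qs ?size_iota.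
Qed.

Lemma is_SRCT_good al t : is_comp al ->
  (t \in fillings al) && is_SRCT al t =
  [&& map size t == al, perm_eq (flatten t) (iota 1 (sumn al)) & good_tableau t].
Proof.
move=> ca; rewrite /is_SRCT /good_tableau; case: (map size t =P al) => [st|_]; rewrite ?andbF //=.
have -> : [::] \notin t.
  apply/negP => /(map_f size); rewrite st => /(allP ca); by [].
case: (boolP (perm_eq _ _)) => [pt|]; rewrite ?andbF //= andbC.
have -> : t \in fillings al; last by rewrite andbT.
apply/mapP; exists (flatten t); first by rewrite mem_permutations.
by rewrite -st -[map size t]/(shape t) flattenK.
Qed.

Lemma dcoefE al be : is_comp al ->
  dcoef al be = count (fun w => (word_shape w == Some al) && (descent_comp w == be)) (words (sumn al)).
Proof.
move=> ca; rewrite /dcoef.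
have P : perm_eq [seq t <- fillings al | is_SRCT al t]
                 [seq tableau_of 1 w | w <- words (sumn al) & word_shape w == Some al].
  (* Reading off the columns of the entries recovers the word, which gives injectivity. *)
  have Ew w : word_shape w = Some al -> [seq (colof (tableau_of 1 w) j).+1 | j <- iota 1 (size w)] = w.
    move=> wa; apply: (@eq_from_nth _ 0); rewrite size_map size_iota // => i iw.
    by rewrite (nth_map 0) ?size_iota // nth_iota // (colof_tableau_of _ _ _ _ wa).
  have sw w : word_shape w = Some al -> size w = sumn al by case/word_shape_props.
  apply: uniq_perm.
  - by apply/filter_uniq; rewrite map_inj_in_uniq ?permutations_uniq //; apply: reshape_inj_permutations.
  - rewrite map_inj_in_uniq; first by apply: filter_uniq; apply: words_uniq.
    move=> w1 w2; rewrite !mem_filter => /andP[/eqP h1 _] /andP[/eqP h2 _] h.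
    by rewrite -(Ew w1) // -(Ew w2) // h !sw.
  move=> t; rewrite mem_filter andbC is_SRCT_good //; apply/and3P/mapP => [[/eqP st pt gt]|].
    have [w wt tw] := tableau_of_surj 1 _ _ gt pt; exists w => //.
    rewrite st in wt; rewrite mem_filter mem_words (sw w wt) eqxx !wt andbT; exact/eqP.
  case=> w; rewrite mem_filter => /andP[/eqP wa _] ->; have [sa pa ga] := tableau_of_good 1 w _ wa.
  by rewrite sa -(sw w).
have -> : count (fun t => is_SRCT al t && (descomp t == be)) (fillings al) =
          count (fun t => descomp t == be) [seq t <- fillings al | is_SRCT al t].
  by rewrite count_filter; apply: eq_count => t /=; rewrite andbC.
rewrite (permP P) count_map count_filter; apply: eq_count => w /=.
by rewrite andbC; case: eqP => // /descomp_tableau_of ->.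
Qed.

(** * Compositions as sequences of comparison bits *)

Lemma comp_of_bits_inj : injective comp_of_bits.
Proof.
have comp_nil b bs : comp_of_bits (b :: bs) != [:: 1].
  by have [x [s /=]] := comp_of_bits_cons bs; case: b => ->.
elim=> [|b B IH] [|b' B'] // => [/esym/eqP|/eqP|]; rewrite ?(negbTE (comp_nil _ _)) //.
have [x [s E]] := comp_of_bits_cons B; have [x' [s' E']] := comp_of_bits_cons B'.
case: b b' => -[] /=; rewrite ?E ?E' /=.
- by case=> xx ss; congr cons; apply: IH; rewrite E E' xx ss.
- by case.
- by case.
- by case=> xx ss; congr cons; apply: IH; rewrite E E' xx ss.
Qed.

Lemma comp_of_bits_is_comp bs : is_comp (comp_of_bits bs) /\ sumn (comp_of_bits bs) = (size bs).+1.
Proof.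
elim: bs => //= b bs [h1 h2]; case: b => /=; first by rewrite h1 h2.
by move: h1 h2; case: (comp_of_bits bs) => //= x s /andP[_ ->]; rewrite addSn => ->.
Qed.

Lemma comp_of_bits_surj b : is_comp b -> b != [::] -> exists B, b = comp_of_bits B.
Proof.
elim: b => //= x b IH /andP[x0 b0] _; have [B BE] : exists B, 1 :: b = comp_of_bits B.
  case: b b0 IH => [|y b] b0 IH; first by exists [::].
  by have [B ->] := IH b0 isT; exists (true :: B).
elim: x x0 => // -[|x] IHx _; first by exists B.
by have [B' /= EB] := IHx isT; exists (false :: B'); rewrite /= -EB.
Qed.

(** The product of two ribbons is the ribbon of the concatenation plus the ribbon of this
    composition; in terms of bits the two differ in a single one. *)
Fixpoint near_concat (b c : seq nat) : seq nat :=
  match b, c with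
  | [::], _ => c
  | [:: x], y :: c' => (x + y) :: c'
  | x :: b', _ => x :: near_concat b' c
  end.

Lemma comp_of_bits_cat_true B C : comp_of_bits (B ++ true :: C) = comp_of_bits B ++ comp_of_bits C.
Proof.
elim: B => //= b B ->; case: b => //.
by have [x [s ->]] := comp_of_bits_cons B.
Qed.

Lemma near_concat_cons x y b c : near_concat [:: x, y & b] c = x :: near_concat (y :: b) c.
Proof. by []. Qed.

Lemma comp_of_bits_cat_false B C :
  comp_of_bits (B ++ false :: C) = near_concat (comp_of_bits B) (comp_of_bits C).
Proof.
have [z [t EC]] := comp_of_bits_cons C; elim: B => [|b B IH] /=; first by rewrite EC.
rewrite IH; have [x [s ->]] := comp_of_bits_cons B; case: b => //.
by case: s {IH} => [|y s] //=; rewrite EC.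
Qed.

(** * Unitriangularity *)

(** Twice the sum of the column numbers of all boxes, so a box added in column [c] contributes
    [2 * c]. *)
Definition twice_weight (a : seq nat) := sumn [seq x * x.+1 | x <- a].

Lemma twice_weight_add_box {c a b} : add_box c a = Some b -> twice_weight b = twice_weight a + 2 * c.
Proof.
case: c => [|[|j]] //; first by case=> <-; rewrite /twice_weight /= addnC.
rewrite add_boxE //; case: ifP => // ja [<-]; rewrite /twice_weight.
elim: a ja => //= x a IH; rewrite inE eq_sym; case: eqP => [-> _|_ /= ja] /=; first nia.
by rewrite IH // addnA.
Qed.

Lemma twice_weight_le_sumn a : twice_weight a <= sumn a * (sumn a).+1.
Proof. by rewrite /twice_weight; elim: a => //= x a IH; nia. Qed.

Lemma descent_comp_cons c w : w != [::] ->
  descent_comp (c :: w) = if c <= head 0 w then 1 :: descent_comp w else incr_head (descent_comp w).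
Proof. by case: w. Qed.

Lemma descent_comp_neq0 w : w != [::] -> exists x s, descent_comp w = x.+1 :: s.
Proof. by case: w => // c w _; apply: comp_of_bits_cons. Qed.

(** The first part is the length of the initial strictly decreasing run, whose letters are
    positive. *)
Lemma head_descent_comp_le w a : word_shape w = Some a -> w != [::] -> head 0 (descent_comp w) <= head 0 w.
Proof.
elim: w a => // c w IH b /word_shape_consP[a wa /add_box_props[c0 _ _ _ _]] _.
case w0: (w == [::]); first by rewrite (eqP w0).
rewrite descent_comp_cons ?w0 //; case: (leqP c (head 0 w)) => //= cw; have := IH a wa; rewrite w0 => /(_ isT).
by case: (descent_comp w) => //= x s xw; apply: leq_trans cw.
Qed.

(* The left side is twice the sum, over the letters of w, of the position counted from the end
   of the decreasing run; the right side is twice the sum of the letters. *)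
Lemma twice_weight_descent_comp_le w a : word_shape w = Some a ->
  twice_weight (descent_comp w) <= twice_weight a /\
  (twice_weight (descent_comp w) = twice_weight a -> descent_comp w = a).
Proof.
elim: w a => [|c w IH] b; first by case=> <-.
move=> wb; case/word_shape_consP: (wb) => a wa ca.
have [le eq] := IH a wa; have hd := head_descent_comp_le _ _ wb isT; have stb := twice_weight_add_box ca.
case w0: (w == [::]).
  move: wa ca; rewrite (eqP w0) => -[<-]; case: (c) => [|[|c']] //= [<-] //.
move: hd; rewrite descent_comp_cons ?w0 //; have [x [s E]] := descent_comp_neq0 w (negbT w0).
case: ifP => cw.
  have -> : twice_weight (1 :: descent_comp w) = twice_weight (descent_comp w) + 2 by rewrite /twice_weight /= addnC.
  move=> /= c1; split; first by lia.
  move=> E2; have c1E : c = 1 by lia.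
  by move: ca; rewrite c1E => -[<-]; rewrite eq //; lia.
rewrite E => /= hc; have -> : twice_weight (x.+2 :: s) = twice_weight (x.+1 :: s) + 2 * x.+2 by rewrite /twice_weight /=; nia.
rewrite E in le eq; split; first by lia.
move=> E2; have cE : c = x.+2 by lia.
have aE : x.+1 :: s = a by apply: eq; lia.
by move: ca; rewrite cE -aE add_boxE // mem_head /= eqxx => -[].
Qed.

(** The word is made of one run [x, x-1, ..., 1] for each part [x], in order. *)
Lemma word_exists b : is_comp b -> exists w, word_shape w = Some b /\ descent_comp w = b.
Proof.
case b0: (b == [::]); first by rewrite (eqP b0); exists [::].
move=> cb; have [B ->] := comp_of_bits_surj b cb (negbT b0).
suff [w [h1 h2 _]] : exists w, [/\ word_shape w = Some (comp_of_bits B), descent_comp w = comp_of_bits B &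
                                  head 0 w = head 0 (comp_of_bits B)] by exists w.
elim: B {cb} => [|b' B [w [h1 h2 h3]]]; first by exists [:: 1].
have [x [s E]] := comp_of_bits_cons B; rewrite E in h1 h2 h3.
have w0 : w != [::] by case: (w) h2.
case: b' => /=; rewrite E.
  exists (1 :: w); rewrite word_shape_cons h1 descent_comp_cons // h3 h2 /=; split=> //.
exists (x.+2 :: w); rewrite word_shape_cons h1 descent_comp_cons // h3 /= ltnn h2; split=> //.
by rewrite mem_head eqxx.
Qed.

Local Open Scope ring_scope.

(** * The iterated slide *)

Section Pieri.
Variables (V : nmodType) (e : bool) (m : nat) (P : pred (seq bool)).

(** [P] restricts the comparisons among the first [m] letters, and [e] prescribes those among the
    later ones; the bit between the two blocks stays free. *)
Let Q (w : seq nat) := P (take m.-1 (descent_bits w)) && all (pred1 e) (drop m (descent_bits w)).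

(** One slide: the comparison with the final 1 becomes the condition on [i]. For [n = 0] that
    comparison, if there is one, is the free bit. *)
Lemma sum_slide n (F : seq nat -> V) :
  \sum_(w <- words (m + n) | Q w)
    \sum_(i <- iota 1 (m + n).+1 | ((n == 0) || strip_rel e (last 0 (shape_of w)) i)%N
                                  && (uop i (shape_of w) != None))
      F (odflt [::] (uop i (shape_of w))) =
  \sum_(u <- words (m + n).+1 | Q u) F (shape_of u).
Proof.
pose G p := F (odflt [::] (uop p.2 (shape_of p.1))).
pose K p := Q p.1 && ((n == 0) || strip_rel e (last 0 (shape_of p.1)) p.2)%N.
transitivity (\sum_(p <- [seq p <- [seq (w, i) | w <- words (m + n), i <- iota 1 (m + n).+1]
                                   | uop p.2 (shape_of p.1) != None] | K p) G p).
  rewrite big_filter_cond [RHS]big_mkcond big_allpairs_dep [LHS]big_mkcond.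
  apply: eq_bigr => w _; case Qw: (Q w).
    by rewrite [LHS]big_mkcond; apply: eq_bigr => i _; rewrite /K Qw andbC.
  by rewrite big1 // => i; rewrite /K Qw andbF.
rewrite -(perm_big _ (perm_slide (m + n))) big_map [LHS]big_seq_cond [RHS]big_seq_cond.
have wordsP u : u \in words (m + n).+1 ->
    [/\ Q u = K (slide (unrcons u)) &
        shape_of u = odflt [::] (uop (slide (unrcons u)).2 (shape_of (slide (unrcons u)).1))].
  rewrite mem_words => /andP[/eqP us]; case E: (word_shape u) => [b|] // _.
  have [|v uv] := word_shape_last E; first by rewrite -size_eq0 us.
  subst u; rewrite unrcons_rcons; have [a [g [[k0 sz wa ag bE] _ dsE lst]]] := slide_spec E.
  rewrite /K /Q /shape_of wa /= E /uop ag /= dsE; split=> //.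
  move: us; rewrite size_rcons => -[sv].
  case v0: (v == [::]).
    move: sv; rewrite (eqP v0) /= => /esym/eqP; rewrite addn_eq0 => /andP[_ /eqP ->] /=.
    by rewrite !andbT.
  have mn : (0 < m + n)%N by rewrite -sv lt0n size_eq0 v0.
  rewrite descent_bits_rcons ?v0 // -cats1 takel_cat ?size_descent_bits ?sv; last by lia.
  rewrite lst ?v0 // -andbA; congr (_ && _); have [n0|n0] := posnP n.
    by rewrite /= !drop_oversize ?size_cat ?size_descent_bits ?sv //=; lia.
  rewrite drop_cat size_descent_bits sv; case: ltnP => h.
    by rewrite all_cat /= andbT; congr (_ && _).
  (* Here [n = 1], and the comparison with the final 1 is the only prescribed one. *)
  have hm : m = (m + n).-1 by lia.
  rewrite [drop m (descent_bits v)]drop_oversize ?size_descent_bits ?sv // [(m - _)%N](_ : _ = 0%N); last by lia.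
  by rewrite /= andbT /strip_rel.

by apply: eq_big => u; [case: (boolP (u \in _)) => //= /wordsP[->]|case/andP=> /wordsP[_ ->]].
Qed.

Lemma sum_strips n (F : seq nat -> V) :
  \sum_(w <- words m | P (take m.-1 (descent_bits w)))
    \sum_(x <- strips e n (shape_of w)) F (odflt [::] (uapp x (shape_of w))) =
  \sum_(u <- words (m + n) | Q u) F (shape_of u).
Proof.
have wP w k : w \in words k -> size w = k /\ sumn (shape_of w) = k.
  rewrite mem_words /shape_of => /andP[/eqP <-]; case E: (word_shape w) => [a|] // _.
  by have [<- _] := word_shape_props E.
elim: n F => [|n IH] F.
  rewrite addn0 big_seq_cond [RHS]big_seq_cond; apply: eq_big => w.
    case: (boolP (w \in _)) => //= /wP[sw _]; rewrite /Q drop_oversize ?andbT //.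
    by rewrite size_descent_bits sw leq_pred.
  by rewrite big_seq1.
(* The sum over the last index is itself a function of the shape, so the induction hypothesis
   applies to it. *)
rewrite addnS -sum_slide -(IH (fun b => \sum_(i <- iota 1 (m + n).+1 |
    ((n == 0) || strip_rel e (last 0 b) i)%N && (uop i b != None)) F (odflt [::] (uop i b)))).
rewrite big_seq_cond [RHS]big_seq_cond.
apply: eq_bigr => w /andP[/wP[sw sa] _].
rewrite /= /strip_step big_map big_filter_cond.
under eq_bigl do rewrite andbT.
rewrite big_mkcond big_allpairs_dep [LHS]big_seq [RHS]big_seq; apply: eq_bigr => x.
rewrite mem_strips => /and4P[/eqP sx x0 _]; case E: (uapp x (shape_of w)) => [b|] // _.
rewrite [RHS]big_mkcond /= sa; apply: eq_bigr => i _.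
have [_ lb] := uapp_props x0 E; rewrite uapp_rcons E /=.
by case: n {IH} sx => [|n] sx //; rewrite lb // -size_eq0 sx.
Qed.
End Pieri.

(** * Products of ribbons *)

Lemma sum_delta (I : eqType) (L : seq I) (i : I) (F : I -> rat) : uniq L ->
  \sum_(j <- L) (i == j)%:R * F j = if i \in L then F i else 0.
Proof.
move=> uL; case: ifP => iL.
  rewrite (bigD1_seq i) //= eqxx mul1r big1 ?addr0 // => j ji.
  by rewrite eq_sym (negbTE ji) mul0r.
rewrite big1_seq // => j /= jL; case: eqP => [E|_]; last by rewrite mul0r.
by rewrite E jL in iL.
Qed.

Lemma comps_recP f m w : (m <= f)%N -> (w \in comps_rec f m) = is_comp w && (sumn w == m).
Proof.
elim: f m w => [|f IH] m w.
  by rewrite leqn0 => /eqP ->; rewrite inE; case: w => //= -[|x] w; rewrite ?andbF // addSn andbF.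
case: m => [|m] mf; first by rewrite inE; case: w => //= -[|x] w; rewrite ?andbF // addSn andbF.
apply/flatten_mapP/idP => [[k]|].
  rewrite mem_iota => /andP[k0 km] /mapP[v]; rewrite IH; last by lia.
  by case/andP=> v0 /eqP sv -> /=; rewrite k0 v0 sv /=; lia.
case: w => // x w /andP[/andP[x0 w0] /eqP s]; rewrite /= in s; exists x; first by rewrite mem_iota x0; lia.
apply: map_f; rewrite IH; last by lia.
by rewrite [is_comp w]w0; apply/eqP; lia.
Qed.

Lemma comps_rec_uniq f m : uniq (comps_rec f m).
Proof.
elim: f m => [|f IH] m //; case: m => [//|m].
apply: (@allpairs_uniq_dep _ (fun=> seq nat) _ (fun k v => k :: v) (iota 1 m.+1)
          (fun k => comps_rec f (m.+1 - k))); first exact: iota_uniq.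
  by move=> k _; exact: IH.
by move=> [k v] [k' v'] _ _ /= [-> ->].
Qed.

Lemma mem_comps m w : (w \in comps m) = is_comp w && (sumn w == m).
Proof. exact: comps_recP. Qed.

(** The coefficient of [h_w] in the ribbon of [b], computed from the left: a letter [y > x] absorbs
    the part [x] at the cost of a sign, and the following parts must supply [y - x]. *)
Fixpoint ribbon_coef (b w : seq nat) : rat :=
  match b, w with
  | [::], _ => (w == [::])%:R
  | _ :: _, [::] => 0
  | x :: b', y :: w' =>
      if y == x then ribbon_coef b' w' else if (x < y)%N then - ribbon_coef b' ((y - x)%N :: w') else 0
  end.

Lemma nmul_nil f g : nmul f g [::] = f [::] * g [::].
Proof. by rewrite /nmul big_ord1. Qed.

Lemma nmul_cons f g y w :
  nmul f g (y :: w) = f [::] * g (y :: w) + nmul (fun v => f (y :: v)) g w.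
Proof. by rewrite /nmul big_ord_recl. Qed.

Lemma eq_nmul f f' g g' : f =1 f' -> g =1 g' -> nmul f g =1 nmul f' g'.
Proof. by move=> ef eg w; apply: eq_bigr => i _; rewrite ef eg. Qed.

Lemma nmul_opp f g w : nmul (fun v => - f v) g w = - nmul f g w.
Proof. by rewrite /nmul -sumrN; apply: eq_bigr => i _; rewrite mulNr. Qed.

Lemma nmul_zero g w : nmul (fun v => 0) g w = 0.
Proof. by rewrite /nmul big1 // => i _; rewrite mul0r. Qed.

Lemma nmul_ribbon_coef_nil g w : nmul (ribbon_coef [::]) g w = g w.
Proof.
case: w => [|y w]; first by rewrite nmul_nil mul1r.
by rewrite nmul_cons nmul_zero mul1r addr0.
Qed.

Lemma nmul_ribbon_coef x b c w : is_comp c -> c != [::] ->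
  nmul (ribbon_coef (x :: b)) (ribbon_coef c) w = ribbon_coef ((x :: b) ++ c) w + ribbon_coef (near_concat (x :: b) c) w.
Proof.
case: c => // z c /andP[z0 _] _; elim: b x w => [|x' b IH] x [|y w]; rewrite ?nmul_nil ?nmul_cons ?mul0r ?addr0 //.
  rewrite add0r /=; case: eqP => [->|yx].
    have -> : (x == x + z)%N = false by lia.
    have -> : (x + z < x)%N = false by lia.
    rewrite addr0; transitivity (nmul (ribbon_coef [::]) (ribbon_coef (z :: c)) w); last exact: nmul_ribbon_coef_nil.
    by apply: eq_nmul => v //; rewrite eqxx.
  case: ltnP => xy; last first.
    have -> : (y == x + z)%N = false by lia.
    have -> : (x + z < y)%N = false by lia.
    by rewrite nmul_zero addr0.
  (* The product has no such term; on the right the concatenation and the near concatenation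
     contribute opposite values. *)
  rewrite nmul_opp; have -> : (y == x + z)%N = (y - x == z)%N by lia.
  have -> : (x + z < y)%N = (z < y - x)%N by lia.
  rewrite subnDA nmul_zero; case: eqP => _; first by rewrite oppr0 addNr.
  by case: ifP => _; rewrite ?opprK ?oppr0 ?addNr ?addrN ?addr0.
rewrite add0r near_concat_cons [(_ :: _) ++ _]/=.
have E v : ribbon_coef [:: x, x' & b] (y :: v) = if y == x then ribbon_coef (x' :: b) v
  else if (x < y)%N then - ribbon_coef (x' :: b) ((y - x)%N :: v) else 0 by [].
rewrite (eq_nmul _ _ _ _ E (frefl _)) [ribbon_coef (x :: _) _]/= [ribbon_coef (x :: near_concat _ _) _]/=.
case: eqP => _; first exact: IH.
case: ifP => _; last by rewrite nmul_zero addr0.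
by rewrite nmul_opp -opprD; congr (- _); have := IH x' ((y - x)%N :: w); rewrite nmul_cons mul0r add0r => ->.
Qed.

(** Either the first block is the single part [x], or removing [x] from it leaves a block of sum
    [y - x]; this matches the recursion of [ribbon_coef]. *)
Lemma coarsen_cons y w x b : is_comp (x :: b) ->
  coarsen (y :: w) (x :: b) =
  (y == x) && coarsen w b || (x < y)%N && coarsen ((y - x)%N :: w) b.
Proof.
case/andP=> x0 b0; rewrite [LHS]/= [coarsen (_ :: w) b]/= take0 drop0 addn0 (eq_sym x).
congr orb; rewrite (iotaDl 1 1) has_map.
have pos k : k \in iota 1 (size b) -> (0 < sumn (take k b))%N.
  rewrite mem_iota => /andP[k0 kb]; case: (b) b0 kb => [|z b'] /=; first by lia.
  by case/andP=> z0 _ _; case: k k0 => //= k _; lia.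
case: ltnP => xy /=.
  apply: eq_in_has => k _; rewrite /=; congr andb.
  by rewrite -(eqn_add2l x (sumn _)) subnKC // ltnW.
apply/hasP => -[k /pos k0 /= /andP[/eqP E _]]; move: xy.
by rewrite -E -{2}(addn0 x) leq_add2l leqNgt k0.
Qed.

Lemma coarsen_sumn a b : is_comp b -> coarsen a b ->
  (size a <= size b)%N /\ sumn a = sumn b.
Proof.
elim: a b => [|x a IH] b b0 /=; first by move/eqP => ->.
case/hasP=> k; rewrite mem_iota => /andP[k0 kb] /andP[/eqP <-].
move: b0; rewrite -{1 4}(cat_take_drop k b) /is_comp all_cat => /andP[_ b0] /(IH _ b0)[h1 ->].
rewrite -sumn_cat !cat_take_drop; split=> //; move: h1; rewrite size_drop => h1.
by apply: leq_ltn_trans h1 _; rewrite ltn_subrL k0 (leq_trans k0) // -ltnS.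
Qed.

Lemma ribbonE b w : is_comp b -> ribbon b w = ribbon_coef b w.
Proof.
move=> b0; have -> : ribbon b w =
    if is_comp w && coarsen w b then (-1) ^+ (size b - size w) else 0.
  rewrite /ribbon /hh big_mkcond /=.
  transitivity (\sum_(a <- comps (sumn b))
     (w == a)%:R * (if coarsen a b then (-1) ^+ (size b - size a) else 0) : rat).
    by apply: eq_bigr => a _; case: ifP => _; rewrite ?mulr0 // mulrC.
  rewrite sum_delta ?comps_rec_uniq // mem_comps; case: ifP => [/andP[-> _] //|].
  case: (is_comp w) => //=; case: ifP => // /(coarsen_sumn _ _ b0)[_ ->].
  by rewrite eqxx.
elim: b w b0 => [|x b IH] [|y w] b0 //; first by rewrite /= andbF.
rewrite coarsen_cons // [ribbon_coef _ _]/=; move: (b0) => /andP[x0 b1].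
case: eqP => [->|yx] /=.
  rewrite ltnn orbF -IH // x0; case: ifP => // _.
case: (ltnP x y) => xy /=; last by rewrite ?andbF.

rewrite -IH //= subn_gt0 xy; have -> : (0 < y)%N by lia.
case: (is_comp w); rewrite /= ?oppr0 //; case: ifP => [|_]; rewrite ?oppr0 //.
move=> /(coarsen_sumn ((y - x)%N :: w) _ b1)[/= sw _].
by rewrite subSS -(subnSK sw) exprS mulN1r.
Qed.

(** Downward induction on [twice_weight]: a word with descent composition [a] has shape [a] or a
    shape of larger weight, where [Z] already vanishes. What remains is a positive multiple of
    [Z a]. *)
Lemma words_inversion m (Z : seq nat -> rat) :
  (forall b, is_comp b -> sumn b = m -> \sum_(w <- words m | descent_comp w == b) Z (shape_of w) = 0) ->
  forall a, is_comp a -> sumn a = m -> Z a = 0.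
Proof.
(* [m * m.+1] bounds the weight, so [k = 0] is impossible. *)
move=> H; suff K k a : is_comp a -> sumn a = m -> (m * m.+1 < twice_weight a + k)%N -> Z a = 0.
  by move=> a ca sa; apply: (K (m * m.+1).+1 a) => //; lia.
elim: k a => [|k IH] a ca sa ak; first by have := twice_weight_le_sumn a; rewrite sa; lia.
have := H a ca sa; rewrite big_seq_cond.
rewrite (eq_bigr (fun w => if shape_of w == a then Z a else 0)); last first.
  move=> w /andP[]; rewrite mem_words /shape_of => /andP[/eqP sw]; case wb: (word_shape w) => [b|] //= _ /eqP dw.
  case: eqP => [-> //|ba]; have [sb cb] := word_shape_props wb.
  have [le eq] := twice_weight_descent_comp_le _ _ wb; rewrite dw in le eq.
  apply: IH => //; first by rewrite sb.
  have : twice_weight a <> twice_weight b by move=> /eq /esym.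
  lia.
have [w [wa dw]] := word_exists a ca.
have ww : w \in words m by rewrite mem_words wa -sa; have [-> _] := word_shape_props wa; rewrite eqxx.
rewrite -big_mkcondr /= -big_filter big_const_seq count_predT iter_addr_0 => /eqP.
rewrite mulrn_eq0 => /orP[|/eqP //]; rewrite size_eq0 => /eqP E.
have : w \in [::] by rewrite -E mem_filter ww dw /shape_of wa !eqxx.
by [].
Qed.

(** * The Pieri rules *)

Lemma ribbon_words s b v : is_ncschur s -> is_comp b ->
  ribbon b v = \sum_(w <- words (sumn b) | descent_comp w == b) s (shape_of w) v.
Proof.
move=> Hs cb; rewrite (Hs b cb) /=.
transitivity (\sum_(a <- comps (sumn b)) \sum_(w <- words (sumn b))
    (shape_of w == a)%:R * ((descent_comp w == b)%:R * s a v)).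
  rewrite big_seq [RHS]big_seq; apply: eq_bigr => a; rewrite mem_comps => /andP[ca /eqP sa].
  rewrite dcoefE // sa -sum1_count natr_sum mulr_suml big_mkcond big_seq [RHS]big_seq.
  apply: eq_bigr => w; rewrite mem_words /shape_of => /andP[_]; case: (word_shape w) => // c _ /=.
  rewrite -[Some c == _]/(c == a).
  by case: (c == a); case: (descent_comp w == b); rewrite ?mul1r ?mul0r.
rewrite exchange_big [RHS]big_mkcond big_seq [RHS]big_seq; apply: eq_bigr => w ww.
rewrite sum_delta ?comps_rec_uniq // mem_comps.
have [sw cw] : sumn (shape_of w) = sumn b /\ is_comp (shape_of w).
  move: ww; rewrite mem_words /shape_of => /andP[/eqP <-].
  by case E: (word_shape w) => [c|] // _; apply: word_shape_props.
by rewrite cw sw eqxx /=; case: ifP; rewrite ?mul1r ?mul0r.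
Qed.

Lemma nmul_suml (I : Type) (L : seq I) (P : pred I) (F : I -> NSym) g v :
  nmul (fun w => \sum_(i <- L | P i) F i w) g v = \sum_(i <- L | P i) nmul (F i) g v.
Proof. by rewrite /nmul exchange_big; apply: eq_bigr => k _; rewrite mulr_suml. Qed.

Lemma comp_of_bits_nseq_false n : comp_of_bits (nseq n false) = [:: n.+1].
Proof. by elim: n => //= n ->. Qed.

Lemma comp_of_bits_nseq_true n : comp_of_bits (nseq n true) = nseq n.+1 1%N.
Proof. by elim: n => //= n ->. Qed.

Fixpoint monotone_word (e : bool) (n : nat) : seq nat :=
  if n is n'.+1 then (if e then 1%N else n) :: monotone_word e n' else [::].

(** With weak ascents onto 1, every letter is 1. With descents only, the shape is one row, and a
    letter exceeding its length must extend it. *)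
Lemma monotone_wordP e w a : word_shape w = Some a -> w != [::] -> all (pred1 e) (descent_bits w) ->
  w = monotone_word e (size w) /\ a = comp_of_bits (nseq (size w).-1 e).
Proof.
elim: w a => // c w IH a /word_shape_consP[b wb cb] _.
case w0: (w == [::]).
  by move: wb cb; rewrite (eqP w0) => -[<-] {IH}; case: c => [|[|c]] //= [<-] _; case: e.
rewrite descent_bits_cons ?w0 //= => /andP[/eqP ce he]; have [wE bE] := IH b wb (negbT w0) he.
have [c0 _ _ _ _] := add_box_props cb.
move: ce cb; rewrite -wE {}bE; case: (size w) wE => [|n] wE; first by rewrite wE in w0.
rewrite wE /=; case: (e) => /= ce.
  by have -> : c = 1%N by [lia]; case.
rewrite comp_of_bits_nseq_false; case: c {c0} ce => [|[|c]] //= ce.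
rewrite inE; case: eqP => // -> [<-].
by rewrite eqxx.
Qed.

Lemma eq_comp_of_bits_nseq e n w : w \in words n.+1 ->
  (descent_comp w == comp_of_bits (nseq n e)) = all (pred1 e) (descent_bits w).
Proof.
rewrite mem_words => /andP[/eqP sw _]; have -> : descent_comp w = comp_of_bits (descent_bits w) by case: (w) sw.
have -> : n = size (descent_bits w) by rewrite size_descent_bits sw.
by rewrite (inj_eq comp_of_bits_inj); apply/eqP/all_pred1P.
Qed.

(** A single word has these comparisons, so the ribbon expansion has one term; this covers both
    [(n)] and [(1^n)], shifted by one in [n]. *)
Lemma ribbon_monotone s e n v : is_ncschur s ->
  ribbon (comp_of_bits (nseq n e)) v = s (comp_of_bits (nseq n e)) v.
Proof.
move=> Hs; have [cg sg] := comp_of_bits_is_comp (nseq n e); rewrite size_nseq in sg.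
rewrite (ribbon_words s) // sg; have [w0 [h1 h2]] := word_exists _ cg.
have w0n : w0 \in words n.+1.
  by rewrite mem_words h1 -sg; have [-> _] := word_shape_props h1; rewrite eqxx.
have P w : w \in words n.+1 -> (descent_comp w == comp_of_bits (nseq n e)) = (w0 == w).
  move=> wn; apply/idP/eqP => [|<-]; last by rewrite h2.
  have A u : u \in words n.+1 -> descent_comp u == comp_of_bits (nseq n e) -> u = monotone_word e n.+1.
    move=> un; rewrite eq_comp_of_bits_nseq // => hu.
    move: un; rewrite mem_words => /andP[/eqP su]; case E: (word_shape u) => [b|] // _.
    by rewrite -su; have [] := monotone_wordP e u b E _ hu; rewrite // -size_eq0 su.
  by move=> /(A w wn) ->; apply: A; rewrite ?h2.
transitivity (\sum_(w <- words n.+1) (w0 == w)%:R * s (shape_of w) v).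
  rewrite big_mkcond big_seq [RHS]big_seq; apply: eq_bigr => w wn.
  by rewrite P //; case: eqP; rewrite ?mul1r ?mul0r.
by rewrite sum_delta ?words_uniq // w0n /shape_of h1.
Qed.

Lemma ribbon_mul b B C v : b = comp_of_bits B ->
  nmul (ribbon b) (ribbon (comp_of_bits C)) v =
  ribbon (comp_of_bits (B ++ true :: C)) v + ribbon (comp_of_bits (B ++ false :: C)) v.
Proof.
move=> ->; have [cB _] := comp_of_bits_is_comp B; have [cC _] := comp_of_bits_is_comp C.
have [c1 _] := comp_of_bits_is_comp (B ++ true :: C); have [c2 _] := comp_of_bits_is_comp (B ++ false :: C).
rewrite (eq_nmul _ _ _ _ (fun w => ribbonE _ w cB) (fun w => ribbonE _ w cC)) !ribbonE //.
rewrite comp_of_bits_cat_true comp_of_bits_cat_false; have [x [t ->]] := comp_of_bits_cons B.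
by rewrite nmul_ribbon_coef //; have [y [u ->]] := comp_of_bits_cons C.
Qed.

(** The two ribbons in the product differ in one bit; together they leave free exactly the bit that
    [sum_strips] leaves free. *)
Lemma pieri_words s e m n b v : is_ncschur s -> is_comp b -> sumn b = m ->
  nmul (ribbon b) (ribbon (comp_of_bits (nseq n e))) v =
  \sum_(w <- words m | descent_comp w == b)
    \sum_(x <- strips e n.+1 (shape_of w)) s (odflt [::] (uapp x (shape_of w))) v.
Proof.
move=> Hs cb sb; have [cg sg] := comp_of_bits_is_comp (nseq n e); rewrite size_nseq in sg.
(* [comp_of_bits] never yields the empty composition, hence the separate value for [m = 0]. *)
pose P bs := (if m == 0%N then [::] else comp_of_bits bs) == b.
transitivity (\sum_(u <- words (m + n.+1) | P (take m.-1 (descent_bits u)) && all (pred1 e) (drop m (descent_bits u)))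
    s (shape_of u) v); last first.
  rewrite -(sum_strips _ e m P n.+1 (fun a => s a v)) big_seq_cond [RHS]big_seq_cond.
  apply: eq_bigl => w; case: (boolP (w \in _)) => //=; rewrite mem_words => /andP[/eqP sw _].
  rewrite take_oversize ?size_descent_bits ?sw // /P -sw; congr (_ == _).
  by case: (w).
case b0: (b == [::]).
  move: sb; rewrite /P (eqP b0) => <- /=.
  have ->: nmul (ribbon [::]) (ribbon (comp_of_bits (nseq n e))) v = ribbon (comp_of_bits (nseq n e)) v.
    rewrite (eq_nmul _ (ribbon_coef [::]) _ (ribbon (comp_of_bits (nseq n e)))) ?nmul_ribbon_coef_nil // => w.
    exact: ribbonE.
  rewrite (ribbon_words s) // sg add0n big_seq_cond [RHS]big_seq_cond; apply: eq_bigl => w.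
  by case: (boolP (w \in _)) => //= wn; rewrite eq_comp_of_bits_nseq // drop0.
have [B BE] := comp_of_bits_surj b cb (negbT b0); rewrite (ribbon_mul _ B) //.
have [c1 s1] := comp_of_bits_is_comp (B ++ true :: nseq n e).
have [c2 s2] := comp_of_bits_is_comp (B ++ false :: nseq n e).
have sB : m = (size B).+1 by rewrite -sb BE; have [] := comp_of_bits_is_comp B.
have sz bit : (size (B ++ bit :: nseq n e)).+1 = (m + n.+1)%N.
  by rewrite size_cat /= size_nseq sB addSn.
rewrite !(ribbon_words s) // s1 s2 !sz big_mkcond [X in _ + X]big_mkcond -big_split /=.
rewrite [RHS]big_mkcond big_seq [RHS]big_seq; apply: eq_bigr => u.
rewrite mem_words => /andP[/eqP su _].
have -> : descent_comp u = comp_of_bits (descent_bits u) by case: (u) su => //; rewrite sB.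
have [bit uE] : exists bit, descent_bits u = take m.-1 (descent_bits u) ++ bit :: drop m (descent_bits u).
  exists (nth false (descent_bits u) m.-1); rewrite -{1}(cat_take_drop m.-1 (descent_bits u)); congr cat.
  by rewrite (drop_nth false) ?size_descent_bits ?su ?prednK //; lia.
have st1 : size (take m.-1 (descent_bits u)) = size B.
  by rewrite size_takel ?size_descent_bits ?su; lia.
have sd : size (drop m (descent_bits u)) = n by rewrite size_drop size_descent_bits su; lia.
have m0 : (m == 0%N) = false by rewrite sB.
rewrite /P m0 BE !(inj_eq comp_of_bits_inj) {1 2}uE !eqseq_cat // !eqseq_cons.
have -> : (drop m (descent_bits u) == nseq n e) = all (pred1 e) (drop m (descent_bits u)).
  by rewrite -{1}sd; apply/eqP/all_pred1P.
by case: (_ == B); case: (all _ _); case: bit {uE}; rewrite /= ?addr0 ?add0r.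
Qed.

(** The product is linear in its left factor, so [pieri_words] makes the differences [Z] of the two
    sides sum to zero over the words of every ribbon; [words_inversion] then gives [Z a = 0]. *)
Lemma pieri s e n a v : is_ncschur s -> is_comp a ->
  nmul (s a) (s (comp_of_bits (nseq n e))) v =
  nsum (strips e n.+1 a) (fun x => s (odflt [::] (uapp x a))) v.
Proof.
move=> Hs ca; apply/eqP; rewrite -subr_eq0; apply/eqP.
pose Z b := nmul (s b) (s (comp_of_bits (nseq n e))) v -
            \sum_(x <- strips e n.+1 b) s (odflt [::] (uapp x b)) v.
apply: (words_inversion (sumn a) Z) => // b cb sb.
rewrite sumrB -(pieri_words _ _ _ _ _ v Hs cb sb).
apply/eqP; rewrite subr_eq0; apply/eqP.
rewrite (eq_nmul _ _ _ _ (fun w => ribbon_words _ _ w Hs cb) (fun w => ribbon_monotone _ _ _ w Hs)).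
by rewrite nmul_suml sb.
Qed.

Theorem theorem5p5 (s : seq nat -> NSym) (Hs : is_ncschur s)
    (alpha : seq nat) (n : nat) (Halpha : is_comp alpha) (Hn : (0 < n)%N) :
  (exists L : seq (seq nat),
     [/\ uniq L, (forall x, (x \in L) = valid_row alpha n x) &
         nmul (s alpha) (s [:: n]) =1
           nsum L (fun x => s (odflt [::] (uapp x alpha)))])
  /\
  (exists L : seq (seq nat),
     [/\ uniq L, (forall x, (x \in L) = valid_col alpha n x) &
         nmul (s alpha) (s (nseq n 1%N)) =1
           nsum L (fun x => s (odflt [::] (uapp x alpha)))]).
Proof.
case: n Hn => // n _; split.
  exists (strips false n.+1 alpha); split=> [|x|v]; first exact: strips_uniq.
    rewrite mem_strips (@eq_sorted _ _ ltn) // => i j.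
    by rewrite /strip_rel eqbF_neg -ltnNge.
  by rewrite -comp_of_bits_nseq_false; apply: pieri.
exists (strips true n.+1 alpha); split=> [|x|v]; first exact: strips_uniq.
  by rewrite mem_strips (@eq_sorted _ _ geq) // => i j; rewrite /strip_rel eqb_id.
by rewrite -comp_of_bits_nseq_true; apply: pieri.
Qed.
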